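(* Let $n\ge2$ and let $E\subset\mathbb R^n$ be a set (not necessarily closed) of Hausdorff $(n-1)$-measure zero. Then $E$ is NED.
   Context: A path (or curve) in $\mathbb R^n$ is a continuous map $\gamma\colon I\to\mathbb R^n$ with $I\subset\mathbb R$ a compact interval; its trace is $|\gamma|=\gamma(I)$. For a family $\Gamma$ of curves in $\mathbb R^n$, the $n$-modulus is $\mathrm{Mod}_n\Gamma=\inf_\rho\int_{\mathbb R^n}\rho^n$, the infimum over all Borel functions $\rho\colon\mathbb R^n\to[0,\infty]$ with $\int_\gamma\rho\,ds\ge1$ for every rectifiable $\gamma\in\Gamma$ ($\mathrm{Mod}_n\Gamma=\infty$ if there are none). A continuum is a compact connected set. $\Gamma(F_1,F_2;\mathbb R^n)$ is the family of curves $\gamma\colon[a,b]\to\mathbb R^n$ with $\gamma(a)\in F_1$, $\gamma(b)\in F_2$. For $E\subset\mathbb R^n$, $\mathcal F_0(E)$ is the family of curves that do not intersect $E$ except possibly at the endpoints (i.e. $\gamma\colon[a,b]\to\mathbb R^n$ with $(|\gamma|\setminus\{\gamma(a),\gamma(b)\})\cap E=\emptyset$). $E$ is NED if $\mathrm{Mod}_n\Gamma(F_1,F_2;\mathbb R^n)=\mathrm{Mod}_n(\Gamma(F_1,F_2;\mathbb R^n)\cap\mathcal F_0(E))$ for every pair of non-empty, disjoint continua $F_1,F_2\subset\mathbb R^n$. *)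

(* Defs.v *)
From HB Require Import structures.
From mathcomp Require Import all_boot all_order all_algebra.
From mathcomp Require Import all_classical all_reals all_analysis
  measurable_realfun.

Set Implicit Arguments.
Unset Strict Implicit.
Unset Printing Implicit Defensive.

Import Order.TTheory GRing.Theory Num.Theory.
Import numFieldNormedType.Exports.

Local Open Scope classical_set_scope.
Local Open Scope ring_scope.

(* Euclidean space is 'rV[R]_n with its library topology.  The library norm
   `|x| on 'rV[R]_n is the sup norm: it induces the right topology, but
   lengths and diameters below must use the Euclidean norm. *)

Section borel.
Context {R : realType} {n : nat}.

Let borelC (A : set 'rV[R]_n) : <<s open >> A -> <<s open >> (~` A).
Proof. by move=> sA; rewrite -setTD; exact: sigma_algebraCD. Qed.

HB.instance Definition _ := @isMeasurable.Build (sigma_display (@open 'rV[R]_n))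
  'rV[R]_n <<s open >> (@sigma_algebra0 _ setT open) borelC
  (@sigma_algebra_bigcup _ setT open).

End borel.

Section lebesgue_measure_rV.
Context {R : realType}.

Definition rcons_rV n (p : 'rV[R]_n * R) : 'rV[R]_n.+1 :=
  \row_(i < n.+1) if unlift ord_max i is Some j then p.1 ord0 j else p.2.

Lemma rcons_rV_lift n (p : 'rV[R]_n * R) (j : 'I_n) :
  rcons_rV p ord0 (lift ord_max j) = p.1 ord0 j.
Proof. by rewrite mxE liftK. Qed.

Lemma rcons_rV_max n (p : 'rV[R]_n * R) : rcons_rV p ord0 ord_max = p.2.
Proof. by rewrite mxE unlift_none. Qed.

Fixpoint lebesgue_rV n : set 'rV[R]_n -> \bar R :=
  match n with
  | 0 => fun A => \d_(0 : 'rV[R]_0) A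
  | n'.+1 => pushforward (@lebesgue_rV n' \x @lebesgue_measure R)%E
               (@rcons_rV n')
  end.

Lemma preimage_rcons_rV_ball n (v : 'rV[R]_n.+1) (e : R) :
  @rcons_rV n @^-1` ball v e =
  ball (\row_j v ord0 (lift ord_max j)) e `*` ball (v ord0 ord_max) e.
Proof.
apply/seteqP; split => [[w x] [e0 /= b]|[w x] [[e0 /= b1] b2]].
  split => /=.
    split => // i j; rewrite mxE !ord1.
    by have := b ord0 (lift ord_max j); rewrite rcons_rV_lift.
  by have := b ord0 ord_max; rewrite rcons_rV_max.
split => // i j; rewrite ord1; case: (unliftP ord_max j) => [k|] ->.
  by rewrite rcons_rV_lift; have := b1 ord0 k; rewrite mxE.
by rewrite rcons_rV_max.
Qed.

Lemma open_measurable_rV n (A : set 'rV[R]_n) : open A -> measurable A.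
Proof. by move=> oA; exact: sub_sigma_algebra. Qed.

Lemma measurable_rcons_rV n : measurable_fun setT (@rcons_rV n).
Proof.
apply: (@measurability _ _ _ _ _ _ (@open 'rV[R]_n.+1)) => // _ [U oU <-].
rewrite setTI.
pose B (qe : 'rV[rat]_n.+1 * rat) : set 'rV[R]_n.+1 :=
  ball (map_mx ratr qe.1 : 'rV[R]_n.+1) (ratr qe.2).
pose F qe := if `[< B qe `<=` U >] then B qe else set0.
have -> : U = \bigcup_qe F qe.
  apply/seteqP; split => [v Uv|v [qe _]]; last first.
    by rewrite /F; case: ifPn => // /asboolP; exact.
  have : nbhs v U by rewrite nbhsE; exists U.
  rewrite -nbhs_ballE => -[e /= e0 veU].
  have /rat_in_itvoo[r] : 0 < e / 2 by rewrite divr_gt0.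
  rewrite in_itv/= => /andP[r0 re].
  have q_ i : {q : rat | `|v ord0 i - ratr q| < ratr r}.
    apply/cid; have : v ord0 i - ratr r < v ord0 i + ratr r.
      by rewrite ltrD2l gtrN.
    move=> /rat_in_itvoo[q]; rewrite in_itv/= => /andP[q1 q2]; exists q.
    by rewrite ltr_distlC q1 q2.
  pose q : 'rV[rat]_n.+1 := \row_i sval (q_ i).
  have qv : ball v (ratr r) (map_mx ratr q).
    split => // i j; rewrite ord1 !mxE; exact: (svalP (q_ j)).
  exists (q, r) => //; rewrite /F; case: ifPn => [_|/asboolP]; first exact: ball_sym.
  case => w qw; apply: veU; rewrite [e]splitr.
  apply: le_ball (ball_triangle qv qw); by rewrite lerD// ltW.
rewrite preimage_bigcup; apply: countable_bigcupT_measurable => // -[q e].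
rewrite /F; case: ifPn => _; last by rewrite preimage_set0.
rewrite /B preimage_rcons_rV_ball; apply: measurableX.
  by apply: open_measurable_rV; exact: ball_open.
by apply: open_measurable; exact: ball_open.
Qed.

Let lebesgue_rV_measure n :
  exists m : {measure set 'rV[R]_n -> \bar R}, @lebesgue_rV n = m.
Proof.
elim: n => [|n [m IH]]; first by exists (\d_(0 : 'rV[R]_0)).
exists (measure_function_pushforward__canonical__measure_function_Measure
  (m \x @lebesgue_measure R)%E (@measurable_rcons_rV n)).
by rewrite /= IH.
Qed.

Let lebesgue_rV0 n : @lebesgue_rV n set0 = 0%E.
Proof. by have [m ->] := lebesgue_rV_measure n; exact: measure0. Qed.

Let lebesgue_rV_ge0 n A : (0 <= @lebesgue_rV n A)%E.
Proof. by have [m ->] := lebesgue_rV_measure n; exact: measure_ge0. Qed.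

Let lebesgue_rV_sigma_additive n : semi_sigma_additive (@lebesgue_rV n).
Proof.
by have [m ->] := lebesgue_rV_measure n; exact: measure_semi_sigma_additive.
Qed.

HB.instance Definition _ n := isMeasure.Build _ _ _ (@lebesgue_rV n)
  (@lebesgue_rV0 n) (@lebesgue_rV_ge0 n) (@lebesgue_rV_sigma_additive n).

Lemma measurable_box_rV n (A : 'I_n -> set R) :
  (forall i, measurable (A i)) ->
  measurable [set v : 'rV[R]_n | forall i, A i (v ord0 i)].
Proof.
move=> mA.
have -> : [set v : 'rV[R]_n | forall i, A i (v ord0 i)] =
    \bigcap_(i in [set: 'I_n]) ((fun v : 'rV[R]_n => v ord0 i) @^-1` A i).
  by apply/seteqP; split => [v Av i _|v Av i]; [exact: Av|exact: (Av i I)].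
apply: fin_bigcap_measurable => // i _.
have mc : measurable_fun [set: 'rV[R]_n] (fun v : 'rV[R]_n => v ord0 i).
  apply: (@measurability _ _ _ _ _ _ (@RGenOpens.G R)).
    exact: RGenOpens.measurableE.
  move=> _ [_ [a [b ->]] <-]; rewrite setTI; apply: open_measurable_rV.
  by apply: open_comp => // v _; exact: coord_continuous.
by rewrite -[X in measurable X]setTI; exact: mc.
Qed.

Lemma lebesgue_rV_box n (A : 'I_n -> set R) :
  (forall i, measurable (A i)) ->
  lebesgue_rV [set v : 'rV[R]_n | forall i, A i (v ord0 i)] =
  (\prod_(i < n) lebesgue_measure (A i))%E.
Proof.
elim: n A => [|n IH] A mA.
  rewrite big_ord0 /= diracE mem_set//.
  by case.
rewrite big_ord_recr /= /pushforward.
have -> : @rcons_rV n @^-1` [set v | forall i, A i (v ord0 i)] =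
    [set v : 'rV[R]_n | forall i, A (lift ord_max i) (v ord0 i)] `*` A ord_max.
  apply/seteqP; split => [p Ap|p [Ap Am] i].
    split => [i|]; first by have := Ap (lift ord_max i); rewrite rcons_rV_lift.
    by have := Ap ord_max; rewrite rcons_rV_max.
  by case: (unliftP ord_max i) => [k|] ->; rewrite ?rcons_rV_lift ?rcons_rV_max.
rewrite product_measure1E; last 2 first.
- exact: (@measurable_box_rV n (fun i => A (lift ord_max i))).
- exact: mA.
congr (_ * _)%E.
rewrite [LHS](IH (fun i => A (lift ord_max i)))//; apply: eq_bigr => i _.
congr (lebesgue_measure (A _)); apply/val_inj => /=.
by rewrite /bump leqNgt ltn_ord.
Qed.

End lebesgue_measure_rV.

Section curves.
Context {R : realType} {n : nat}.
Implicit Types (x y : 'rV[R]_n) (A E F : set 'rV[R]_n).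

Definition enorm x : R := Num.sqrt (\sum_(i < n) x ord0 i ^+ 2).

(* Values of [cfun] outside [cstart, cend] are irrelevant. *)
Record curve := Curve {
  cstart : R;
  cend : R;
  cfun :> R -> 'rV[R]_n;
  cstart_le_cend : cstart <= cend;
  curve_continuous : {within `[cstart, cend], continuous cfun} }.

Implicit Types (g : curve) (G : set curve).

Definition trace g : set 'rV[R]_n := g @` `[cstart g, cend g].

Definition polygonal_length (f : R -> 'rV[R]_n) (a b : R) (s : seq R) : R :=
  let F := f \o nth b (a :: s) in
  \sum_(0 <= k < size s) enorm (F k.+1 - F k).

Definition length_upto g (t : R) : \bar R :=
  ereal_sup [set (polygonal_length g (cstart g) t s)%:E |
             s in itv_partition (cstart g) t].

Definition curve_length g : \bar R := length_upto g (cend g).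

Definition rectifiable g : Prop := (curve_length g < +oo)%E.

(* The arclength parametrization on [0, curve_length g]: for rectifiable [g]
   the length function is continuous and nondecreasing on [cstart g, cend g],
   so the infimum below is a point t with [length_upto g t = s]. *)
Definition arclength_param g (s : R) : 'rV[R]_n :=
  g (inf [set t | t \in `[cstart g, cend g] /\ (s%:E <= length_upto g t)%E]).

Definition line_integral g (rho : 'rV[R]_n -> \bar R) : \bar R :=
  (\int[@lebesgue_measure R]_(s in `[0%R, fine (curve_length g)])
     rho (arclength_param g s))%E.

Definition admissible G (rho : 'rV[R]_n -> \bar R) : Prop :=
  [/\ measurable_fun setT rho, forall x, (0 <= rho x)%E &
      forall g, G g -> rectifiable g -> (1 <= line_integral g rho)%E].

Definition modulus G : \bar R :=
  ereal_inf [set (\int[@lebesgue_rV R n]_x (rho x ^+ n))%E |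
             rho in admissible G].

Definition curves_between F1 F2 : set curve :=
  [set g : curve | F1 (g (cstart g)) /\ F2 (g (cend g))].

Definition curves_off E : set curve :=
  [set g : curve |
    (trace g `\` [set g (cstart g); g (cend g)]) `&` E = set0].

Definition continuum F : Prop := compact F /\ connected F.

Definition NED E : Prop := forall F1 F2,
  continuum F1 -> continuum F2 -> F1 !=set0 -> F2 !=set0 ->
  F1 `&` F2 = set0 ->
  modulus (curves_between F1 F2) =
  modulus (curves_between F1 F2 `&` curves_off E).

End curves.

Arguments curve R n : clear implicits.

Section hausdorff_measure.
Context {R : realType} {n : nat}.
Implicit Types (A : set 'rV[R]_n) (s d : R).

(* [ediam set0 = -oo] *)
Definition ediam A : \bar R :=
  ereal_sup [set (enorm (p.1 - p.2))%:E | p in A `*` A].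

(* The empty set contributes 0 also when [s = 0]. *)
Definition hausdorff_gauge s A : \bar R :=
  if A == set0 then 0%E else (ediam A `^ s)%E.

Definition hausdorff_content s d A : \bar R :=
  ereal_inf [set (\sum_(0 <= i <oo) hausdorff_gauge s (U i))%E |
    U in [set U : nat -> set 'rV[R]_n |
          A `<=` \bigcup_i U i /\ forall i, (ediam (U i) <= d%:E)%E]].

(* Without the normalizing constant, which does not affect null sets. *)
Definition hausdorff_measure s A : \bar R :=
  ereal_sup [set hausdorff_content s d A | d in [set d | 0 < d]].

End hausdorff_measure.

(* Main.v *)
From HB Require Import structures.
Require Import Defs.
From mathcomp Require Import all_boot all_order all_algebra.
From mathcomp Require Import all_classical all_reals all_analysis.
From mathcomp Require Import measurable_realfun ring lra.

(** The modulus of all curves from F1 to F2 dominates that of the curves off E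
by monotonicity.  For the converse let rho be admissible for the curves from F1
to F2 off E, let F be the union of F1 and F2, let 0 < e < 1, and put
d(x) = e * dist(x, F), the distance being that of the sup norm.  The function
rho is replaced by its average A(x) over the sup-norm ball of radius d(x)
centred at x.  Since this radius vanishes on F, averaging amounts to moving
curves without moving their endpoints.

Admissibility.  Parametrize a rectifiable curve from F1 to F2 by arclength and
keep the part h between its last exit from F1 and its next entrance in F2.  For
y in the unit ball, the path h(s) + d(h(s)) y still goes from F1 to F2, with the
same endpoints as h, and it is (1 + e n)-Lipschitz.  As E has Hausdorff
(n-1)-measure zero and h has finite length, the set of those y for which the
path meets E strictly between its endpoints is Lebesgue null
([hitting_negligible]): away from F, a set of diameter r is met only for y in
about length(h) / r balls of radius comparable to r.  So for almost every y the
integral of rho along the path is at least 1; averaging over y, with Tonelli's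
theorem, bounds the integral of A along h from below by 1 / (1 + e n).  Hence
(1 + e n) A is admissible for all curves from F1 to F2
([admissible_average]).

Energy.  By the power mean inequality and Tonelli's theorem the integral of A^n
is at most that of rho^n times k, where k(z) is the integral over x of the
density at z of the uniform law on the ball of radius d(x) centred at x.  As d
is e-Lipschitz, the points x that contribute are at distance at most
d(z) / (1 - e) from z and satisfy d(x) >= d(z) / (1 + e), so that
k <= ((1 + e) / (1 - e))^n ([integral_average_pow]).  Letting e tend to 0 ends
the proof. *)

Import Order.TTheory GRing.Theory Num.Theory.
Import numFieldNormedType.Exports.

Set Implicit Arguments.
Unset Strict Implicit.
Unset Printing Implicit Defensive.

Local Open Scope classical_set_scope.
Local Open Scope ring_scope.

#[local] Arguments lebesgue_rV {R n} _ : simpl never.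

(** * Borel sets and Lebesgue measure on row vectors *)

Section measure_rV.
Context {R : realType}.

Lemma continuous_measurable_fun_rV n (f : 'rV[R]_n -> R) :
  continuous f -> measurable_fun setT f.
Proof.
move=> cf; apply: (@measurability _ _ _ _ _ _ (@RGenOpens.G R)).
  exact: RGenOpens.measurableE.
move=> _ [_ [a [b ->]] <-]; rewrite setTI; apply: open_measurable_rV.
by apply: open_comp => // v _; exact: cf.
Qed.

Lemma measurable_coord n (i : 'I_n) :
  measurable_fun [set: 'rV[R]_n] (fun v : 'rV[R]_n => v ord0 i).
Proof. by apply: continuous_measurable_fun_rV; exact: coord_continuous. Qed.

(** Induction on n: row vectors of size n.+1 are the image of a product under
[rcons_rV]. *)
Lemma measurable_fun_rV n d (T : measurableType d) (f : T -> 'rV[R]_n) :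
  (forall i, measurable_fun setT (fun t => f t ord0 i)) ->
  measurable_fun setT f.
Proof.
elim: n f => [|n IH] f mf.
  have -> : f = cst 0 by apply/funext => t; apply/rowP; case.
  exact: measurable_cst.
rewrite (_ : f = @rcons_rV R n \o
    (fun t => (\row_j f t ord0 (lift ord_max j), f t ord0 ord_max))).
  apply: measurableT_comp; first exact: measurable_rcons_rV.
  apply: measurable_fun_pair => //; apply: IH => i.
  by under eq_fun do rewrite mxE; exact: mf.
apply/funext => t; apply/rowP => i; rewrite /=.
case: (unliftP ord_max i) => [k|] ->.
  by rewrite rcons_rV_lift mxE.
by rewrite rcons_rV_max.
Qed.

(** Open boxes, unlike balls, are stable under intersection; with
[measurable_rVE] this makes them determine a measure. *)
Definition open_box n : set (set 'rV[R]_n) :=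
  [set A | exists ab : 'I_n -> R * R,
     A = [set v : 'rV[R]_n | forall i, `](ab i).1, (ab i).2[%classic (v ord0 i)]].

Lemma open_box_setI n : setI_closed (@open_box n).
Proof.
move=> _ _ [ab ->] [cd ->].
exists (fun i => (Num.max (ab i).1 (cd i).1, Num.min (ab i).2 (cd i).2)).
apply/seteqP; split => [v [h1 h2] i|v h] /=.
  have := h1 i; have := h2 i; rewrite /= !in_itv/= gt_max lt_min.
  by move=> /andP[c1 c2] /andP[a1 a2]; rewrite a1 c1 a2 c2.
by split=> i; have := h i; rewrite /= !in_itv/= gt_max lt_min;
  move=> /andP[/andP[a1 c1] /andP[a2 c2]]; apply/andP.
Qed.

Definition centered_box n (k : nat) : set 'rV[R]_n :=
  [set v : 'rV[R]_n | forall i, `](- k%:R), (k%:R)[%classic (v ord0 i)].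

Lemma open_box_centered n k : open_box (@centered_box n k).
Proof. by exists (fun=> (- k%:R, k%:R)). Qed.

Lemma bigcup_centered_box n : \bigcup_k @centered_box n k = setT.
Proof.
apply/seteqP; split => // v _.
exists (Num.truncn (\sum_i `|v ord0 i|)).+1 => // i /=.
rewrite in_itv/= -ltr_norml.
apply: le_lt_trans (truncnS_gt _).
by rewrite (bigD1 i)//= lerDl sumr_ge0.
Qed.

Lemma measurable_open_box n (A : set 'rV[R]_n) : open_box A -> measurable A.
Proof. by move=> [ab ->]; exact: (@measurable_box_rV R n (fun i => `](ab i).1,
  (ab i).2[%classic)). Qed.

(** The identity map is measurable from the sigma-algebra generated by boxes to
the Borel one as soon as its coordinates are, and a slab is a countable union of
boxes.  This spares decomposing open sets into boxes. *)
Lemma measurable_rVE n : @measurable _ 'rV[R]_n = <<s @open_box n >>.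
Proof.
apply/seteqP; split; last first.
  apply: smallest_sub; first exact: sigma_algebra_measurable.
  by move=> A; exact: measurable_open_box.
move=> A mA.
pose T := g_sigma_algebraType (@open_box n).
have : measurable_fun [set: T] (idfun : T -> 'rV[R]_n).
  apply: measurable_fun_rV => i.
  apply: (@measurability _ _ _ _ _ _ (@RGenOpens.G R)).
    exact: RGenOpens.measurableE.
  move=> _ [_ [a [b ->]] <-]; rewrite setTI.
  pose B k : set 'rV[R]_n := [set v | forall j,
     `](if j == i then a else - k%:R), (if j == i then b else k%:R)[%classic (v ord0 j)].
  rewrite [X in measurable X](_ : _ = \bigcup_k B k).
    apply: bigcup_measurable => k _; apply: sub_sigma_algebra.
    exists (fun j => (if j == i then a else - k%:R, if j == i then b else k%:R)).
    by [].
  apply/seteqP; split => [v /= vab|v [k _] /(_ i)]; last by rewrite /= eqxx.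
  have : (\bigcup_k @centered_box n k) v by rewrite bigcup_centered_box.
  by move=> [k _ kv]; exists k => // j /=; case: eqP => [->//|_]; exact: kv.
by move=> /(_ measurableT _ mA); rewrite setTI.
Qed.

Lemma lebesgue_open_box n (ab : 'I_n -> R * R) :
  (forall i, (ab i).1 <= (ab i).2) ->
  lebesgue_rV [set v : 'rV[R]_n | forall i, `](ab i).1, (ab i).2[%classic (v ord0 i)] =
  (\prod_i ((ab i).2 - (ab i).1))%:E.
Proof.
move=> leab; rewrite (lebesgue_rV_box (A := fun i => `](ab i).1, (ab i).2[%classic))//.
elim/big_ind2 : _ => // [x1 x2 y1 y2 -> ->|i _]; first by rewrite EFinM.
rewrite lebesgue_measure_itv/= lte_fin; have := leab i.
by rewrite le_eqVlt => /predU1P[->|->]; rewrite ?ltxx ?subrr// EFinB.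
Qed.

Lemma lebesgue_centered_box_lty n k : (lebesgue_rV (@centered_box n k) < +oo)%E.
Proof.
rewrite (lebesgue_open_box (ab := fun=> (- k%:R, k%:R)))//= ?ltry// => i.
by rewrite -subr_ge0 opprK addr_ge0.
Qed.

Lemma lebesgue_rV_sigma_finite n : sigma_finite setT (@lebesgue_rV R n).
Proof.
exists (@centered_box n); first by rewrite bigcup_centered_box.
move=> k; split.
  by apply: measurable_open_box; exact: open_box_centered.
exact: lebesgue_centered_box_lty.
Qed.

HB.instance Definition _ n := Measure_isSigmaFinite.Build _ _ _
  (@lebesgue_rV R n) (@lebesgue_rV_sigma_finite n).

End measure_rV.

Section scaling.
Context {R : realType} {n : nat}.

Lemma measurable_homothety (x : 'rV[R]_n) (r : R) :
  measurable_fun setT (fun y : 'rV[R]_n => x + r *: y).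
Proof.
apply: measurable_fun_rV => i; under eq_fun do rewrite !mxE.
apply: measurable_funD => //; apply: measurable_funM => //.
exact: measurable_coord.
Qed.

(** Both sides are measures in A, and they agree on open boxes. *)
Lemma lebesgue_rV_homothety (x : 'rV[R]_n) (r : R) (A : set 'rV[R]_n) :
  0 < r -> measurable A ->
  lebesgue_rV A = ((r ^+ n)%:E * lebesgue_rV ((fun y => x + r *: y)%R @^-1` A))%E.
Proof.
move=> r0 mA; have rn0 : 0 <= r ^+ n by rewrite exprn_ge0// ltW.
pose m2 := mscale (NngNum rn0)
  (measure_function_pushforward__canonical__measure_function_Measure
    (@lebesgue_rV R n) (measurable_homothety x r)).
have m2E B : m2 B = ((r ^+ n)%:E * lebesgue_rV ((fun y => x + r *: y)%R @^-1` B))%E.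
  by [].
rewrite -m2E.
apply: (@measure_unique _ R _ (@open_box R n) (@centered_box R n)) => //.
- exact: measurable_rVE.
- exact: open_box_setI.
- by move=> k; exact: open_box_centered.
- exact: bigcup_centered_box.
- move=> _ [ab ->]; apply: etrans (esym (m2E _)).
  have [h|] := pselect (forall i, (ab i).1 <= (ab i).2); last first.
    move=> /existsNP[i /negP]; rewrite -ltNge => ba.
    have E (v : 'rV[R]_n) : ~ (forall i, `](ab i).1, (ab i).2[%classic (v ord0 i : R)).
      by move=> /(_ i); rewrite /= in_itv/= => /andP[/lt_trans h /h]/(lt_trans
        ba); rewrite ltxx.
    rewrite (_ : [set v : 'rV[R]_n | forall i, `](ab i).1, (ab i).2[%classic (v
      ord0 i)] = set0); last first.
      by apply/seteqP; split => // v /E.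
    by rewrite preimage_set0 !measure0 mule0.
  pose cd i := (((ab i).1 - x ord0 i) / r, ((ab i).2 - x ord0 i) / r).
  apply: (etrans (lebesgue_open_box h)); rewrite [X in (_ * lebesgue_rV X)%E](_ : _ =
    [set v : 'rV[R]_n | forall i, `](cd i).1, (cd i).2[%classic (v ord0 i)]).
    rewrite lebesgue_open_box => [|i]; last first.
      by rewrite ler_pM2r ?invr_gt0// lerD2r.
    rewrite -EFinM; congr EFin.
    have -> : r ^+ n = \prod_(i < n) r by rewrite prodr_const card_ord.
    rewrite -big_split/=.
    by apply: eq_bigr => i _; field; rewrite gt_eqF.
  apply/seteqP; split => v /= h' i; have := h' i; rewrite !in_itv/= !mxE.
    by rewrite ltr_pdivrMr// ltr_pdivlMr// mulrC ltrBlDl ltrBrDl.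
  by rewrite ltr_pdivrMr// ltr_pdivlMr// mulrC ltrBlDl ltrBrDl.
- by move=> k; exact: lebesgue_centered_box_lty.
Qed.

Lemma ge0_integral_homothety (x : 'rV[R]_n) (r : R) (f : 'rV[R]_n -> \bar R) :
  0 < r -> measurable_fun setT f -> (forall z, 0 <= f z)%E ->
  (\int[@lebesgue_rV R n]_z f z =
   (r ^+ n)%:E * \int[@lebesgue_rV R n]_y f (x + r *: y)%R)%E.
Proof.
move=> r0 mf f0; have rn0 : 0 <= r ^+ n by rewrite exprn_ge0// ltW.
have mh := measurable_homothety x r.
pose m1 := measure_function_pushforward__canonical__measure_function_Measure
    (@lebesgue_rV R n) mh.
pose m2 := mscale (NngNum rn0) m1.
rewrite (eq_measure_integral m2); last first.
  by move=> A mA _; exact: (lebesgue_rV_homothety x r0 mA).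
rewrite ge0_integral_mscale//; congr (_ * _)%E.
by rewrite (ge0_integral_pushforward mh)// preimage_setT.
Qed.

End scaling.

(** * The power mean inequality *)

Section jensen.
Context {R : realType}.

(** The graph of a convex power lies above its tangent at a. *)
Lemma tangent_pow (m : nat) (a t : R) : 0 <= a -> 0 <= t ->
  (m.+1%:R * a ^+ m) * t <= t ^+ m.+1 + m%:R * a ^+ m.+1.
Proof.
move=> a0 t0; elim: m => [|m IH]; first by rewrite expr0 mulr1 mul1r mul0r addr0 expr1.
have am0 : 0 <= a ^+ m by rewrite exprn_ge0.
have := ler_wpM2r t0 IH; have -> : m.+2%:R = m%:R + 2 :> R by rewrite -natrD addn2.
have : 0 <= m.+1%:R * a ^+ m * (t - a) ^+ 2.
  exact: mulr_ge0 (mulr_ge0 (ler0n _ _) am0) (sqr_ge0 _).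
have -> : m.+1%:R = m%:R + 1 :> R by rewrite natr1.
rewrite !exprSr expr0 !mul1r.
set A := a ^+ m; set T := t ^+ m; lra.
Qed.

Lemma tangent_pow_ereal (m : nat) (a : R) (t : \bar R) : 0 <= a -> (0 <= t)%E ->
  ((m.+1%:R * a ^+ m)%:E * t <= t ^+ m.+1 + (m%:R * a ^+ m.+1)%:E)%E.
Proof.
move=> a0; case: t => [t| |]//; last first.
  move=> _; rewrite (_ : (+oo ^+ m.+1)%E = +oo%E) ?addye ?leey//.
  by elim: m => // m IH; rewrite expeS IH mulyy.
rewrite lee_fin => t0; rewrite -EFin_expe -EFinM -EFinD lee_fin.
exact: tangent_pow.
Qed.

Lemma measurable_fun_expe d (T : measurableType d) (f : T -> \bar R) k :
  measurable_fun setT f -> measurable_fun setT (fun x => f x ^+ k)%E.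
Proof.
move=> mf; elim: k => [|k IH]; first exact: measurable_cst.
by under eq_fun do rewrite expeS; exact: emeasurable_funM.
Qed.

(** Integrating the tangent inequality at a = \int k f gives the claim when this
mean is finite, without any integrability of f; when it is infinite, the tangent
at 1 shows that the right-hand side is infinite too. *)
Lemma power_mean d (T : measurableType d) (mu : {measure set T -> \bar R})
    (k : T -> R) (f : T -> \bar R) (m : nat) :
  measurable_fun setT k -> measurable_fun setT f ->
  (forall x, 0 <= k x) -> (forall x, 0 <= f x)%E ->
  (\int[mu]_x (k x)%:E <= 1)%E ->
  ((\int[mu]_x ((k x)%:E * f x)) ^+ m.+1 <=
   \int[mu]_x ((k x)%:E * f x ^+ m.+1))%E.
Proof.
move=> mk mf k0 f0 k1.
have mK : measurable_fun setT (EFin \o k) by exact/measurable_EFinP.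
have mkf : measurable_fun setT (fun x => (k x)%:E * f x)%E by exact: emeasurable_funM.
have mkP : measurable_fun setT (fun x => (k x)%:E * f x ^+ m.+1)%E.
  by apply: emeasurable_funM => //; exact: measurable_fun_expe.
set A := (\int[mu]_x _)%E; set P := (\int[mu]_x _)%E.
have A0 : (0 <= A)%E by apply: integral_ge0 => x _; rewrite mule_ge0 ?lee_fin.
have main (a : R) : 0 <= a ->
    ((m.+1%:R * a ^+ m)%:E * A <= P + (m%:R * a ^+ m.+1)%:E)%E.
  move=> a0.
  have c0 : (0 <= (m.+1%:R * a ^+ m)%:E)%E by rewrite lee_fin mulr_ge0 ?exprn_ge0.
  have d0 : (0 <= (m%:R * a ^+ m.+1)%:E)%E by rewrite lee_fin mulr_ge0 ?exprn_ge0.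
  rewrite -ge0_integralZl//; last by move=> x _; rewrite mule_ge0 ?lee_fin.
  apply: (@le_trans _ _ (\int[mu]_x ((k x)%:E * f x ^+ m.+1 +
      (m%:R * a ^+ m.+1)%:E * (k x)%:E))%E).
    apply: ge0_le_integral => //.
    - by move=> x _; rewrite !mule_ge0 ?lee_fin.
    - exact: measurable_funeM.
    - by apply: emeasurable_funD => //; exact: measurable_funeM.
    move=> x _; rewrite muleCA [X in (_ + X)%E]muleC -ge0_muleDr//; last first.
      exact: expe_ge0.
    by apply: lee_wpmul2l; rewrite ?lee_fin//; exact: tangent_pow_ereal.
  rewrite ge0_integralD//; last 3 first.
    by move=> x _; rewrite mule_ge0 ?lee_fin// expe_ge0.
    by move=> x _; rewrite mule_ge0 ?lee_fin.
    exact: measurable_funeM.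
  rewrite leeD2l// ge0_integralZl//; last first.
    by move=> x _; rewrite lee_fin.
  by rewrite -[leRHS]mule1 lee_wpmul2l.
have P0 : (0 <= P)%E.
  by apply: integral_ge0 => x _; rewrite mule_ge0 ?lee_fin ?expe_ge0.
move: A0 main; case: A => [r| |]// r0 main.
  have := main _ r0; case: P P0 {main} => [p| |]// p0; last by move=> _; exact: leey.
  rewrite -EFin_expe -EFinM -EFinD !lee_fin -mulrA -exprSr -natr1 mulrDl mul1r.
  by rewrite addrC lerD2r.
have := main 1 ler01; rewrite !expr1n !mulr1 gt0_muley ?lte_fin//.
by case: P P0 {main} => [p| |]// p0; rewrite ?leey.
Qed.

End jensen.

(** * Sup-norm balls *)

Section norm_rV.
Context {R : realType} {n : nat}.

Lemma rV_norm_leP (v : 'rV[R]_n) (r : R) : 0 <= r ->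
  (`|v| <= r) <-> (forall i, `|v ord0 i| <= r).
Proof.
move=> r0; rewrite [`|v|]mx_normrE; split.
  move=> /bigmax_leP[_ h] i; exact: (h (ord0, i)).
move=> h; apply/bigmax_leP; split => // -[i j] _ /=; rewrite ord1; exact: h.
Qed.

Lemma measurable_fun_rV_norm : measurable_fun setT (fun v : 'rV[R]_n => `|v|).
Proof. by apply: continuous_measurable_fun_rV; exact: norm_continuous. Qed.

Definition cube (x : 'rV[R]_n) (r : R) : set 'rV[R]_n := [set z | `|z - x| <= r].

Lemma cubeE x r : 0 <= r -> cube x r =
  [set v | forall i, `[x ord0 i - r, x ord0 i + r]%classic (v ord0 i)].
Proof.
move=> r0; apply/seteqP; split => z /=.
  by move=> /(rV_norm_leP _ r0) h i; have := h i; rewrite !mxE in_itv/= ler_distl.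
move=> h; apply/(rV_norm_leP _ r0) => i; have := h i.
by rewrite !mxE in_itv/= ler_distl.
Qed.

Lemma measurable_cube x r : 0 <= r -> measurable (cube x r).
Proof.
move=> r0; rewrite cubeE//.
exact: (@measurable_box_rV R n (fun i => `[x ord0 i - r, x ord0 i + r]%classic)).
Qed.

Lemma lebesgue_cube x r : 0 <= r -> lebesgue_rV (cube x r) = ((2 * r) ^+ n)%:E.
Proof.
move=> r0; rewrite cubeE//.
rewrite (lebesgue_rV_box (A := fun i => `[x ord0 i - r, x ord0 i + r]%classic))//.
rewrite -[in RHS](card_ord n) -prodr_const.
elim/big_ind2 : _ => // [x1 x2 y1 y2 -> ->|i _]; first by rewrite EFinM.
rewrite lebesgue_measure_itv/= lte_fin.
have -> : x ord0 i + r = x ord0 i - r + 2 * r by ring.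
rewrite ltrDl; case: ltP => [_|].
  by rewrite -EFinB; congr EFin; ring.
by move=> h; congr EFin; lra.
Qed.

Lemma integral_le_cube (g : 'rV[R]_n -> R) (c r : R) (x : 'rV[R]_n) : 0 <= r -> 0 <= c ->
  measurable_fun setT g -> (forall z, 0 <= g z) -> (forall z, g z <= c) ->
  (forall z, r < `|z - x| -> g z = 0) ->
  (\int[@lebesgue_rV R n]_z (g z)%:E <= (c * (2 * r) ^+ n)%:E)%E.
Proof.
move=> r0 c0 mg g0 gc gr; have mc := measurable_cube x r0.
have -> : ((c * (2 * r) ^+ n)%:E = \int[@lebesgue_rV R n]_z (c%:E *
  (\1_(cube x r) z)%:E))%E.
  rewrite ge0_integralZl//.
  - by rewrite integral_indic// setIT EFinM; congr (_ * _)%E;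
      rewrite -(lebesgue_cube x r0).
  - by apply/measurable_EFinP; exact: measurable_indic.
apply: ge0_le_integral => //.
- by move=> z _; rewrite lee_fin.
- exact/measurable_EFinP.
- by apply: measurable_funeM; apply/measurable_EFinP; exact: measurable_indic.
move=> z _; rewrite -EFinM lee_fin indicE; case: (ltP r `|z - x|) => zr.
  by rewrite gr// mulr_ge0.
by rewrite mem_set// mulr1.
Qed.

End norm_rV.

(** * Averages over balls of variable radius *)

Section averaging.
Context {R : realType} {m : nat}.
Local Notation n := m.+1.
Local Notation V := 'rV[R]_n.
Local Notation leb := (@lebesgue_rV R n).
Variables (dl : V -> R) (e : R).
Hypotheses (e0 : 0 <= e) (e1 : e < 1) (dl0 : forall x, 0 <= dl x).
Hypothesis dl_lip : forall x z, `|dl x - dl z| <= e * `|x - z|.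

(** As a function of z, the density of the uniform law on the ball of radius dl x
centred at x.  Where dl vanishes it is 0, because 0^-1 = 0 and n > 0. *)
Definition kern (x z : V) : R :=
  if `|z - x| <= dl x then (2 * dl x)^-1 ^+ n else 0.

Definition average (f : V -> \bar R) (x : V) : \bar R :=
  (\int[leb]_z ((kern x z)%:E * f z))%E.

Lemma kern_ge0 x z : 0 <= kern x z.
Proof. by rewrite /kern; case: ifP => // _; rewrite exprn_ge0// invr_ge0 mulr_ge0. Qed.

Lemma dl_continuous : continuous dl.
Proof.
move=> x A /nbhs_ballP[eps eps0 epsA]; apply/nbhs_ballP; exists eps => // z.
rewrite mx_norm_ball /ball_ /= => xz; apply: epsA; rewrite /ball /=.
rewrite (le_lt_trans (dl_lip _ _))// (le_lt_trans _ xz)//.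
by rewrite ler_piMl// ltW.
Qed.

Lemma measurable_dl : measurable_fun setT dl.
Proof. exact: continuous_measurable_fun_rV dl_continuous. Qed.

Lemma measurable_kern : measurable_fun setT (fun p : V * V => kern p.1 p.2).
Proof.
have md : measurable_fun setT (fun p : V * V => dl p.1).
  by apply: (measurableT_comp measurable_dl); exact: measurable_fst.
apply: measurable_fun_ifT => //.
  apply: measurable_fun_ler => //.
  apply: (measurableT_comp (@measurable_fun_rV_norm R n)).
  apply: measurable_fun_rV => i; under eq_fun do rewrite !mxE.
  apply: measurable_funB.
    by apply: (measurableT_comp (@measurable_coord R n i)); exact: measurable_snd.
  by apply: (measurableT_comp (@measurable_coord R n i)); exact: measurable_fst.
apply: (@eq_measurable_fun _ _ _ _ _ (fun p : V * V => ((2 * dl p.1) `^ (-1)) ^+ n)).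
  by move=> p _; rewrite powR_inv1// mulr_ge0.
apply: measurable_funX.
apply: (measurableT_comp (measurable_powR (-1)) (g := fun p : V * V => 2 * dl p.1)).
by apply: measurable_funM.
Qed.

Lemma measurable_kern1 x : measurable_fun setT (kern x).
Proof. exact: (measurableT_comp measurable_kern (measurable_pair1 x)). Qed.

Lemma measurable_kern2 z : measurable_fun setT (kern ^~ z).
Proof. exact: (measurableT_comp measurable_kern (measurable_pair2 z)). Qed.

Lemma integral_kern_le1 x : (\int[leb]_z (kern x z)%:E <= 1)%E.
Proof.
have c0 : 0 <= (2 * dl x)^-1 ^+ n by rewrite exprn_ge0// invr_ge0 mulr_ge0.
apply: (le_trans (@integral_le_cube R n (kern x) _ _ x (dl0 x) c0 _ _ _ _)).
- exact: measurable_kern1.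
- exact: kern_ge0.
- by move=> z; rewrite /kern; case: ifP.
- by move=> z; rewrite /kern leNgt => ->.
rewrite lee_fin -exprMn; have := dl0 x; rewrite le_eqVlt => /predU1P[<-|d0].
  by rewrite mulr0 mulr0 expr0n.
by rewrite mulVf ?expr1n// mulf_neq0// gt_eqF.
Qed.

(** The radius varies slowly: on the support of [kern] the radii at the two
points are comparable, with constants close to 1. *)
Lemma kern_comparable x z : `|z - x| <= dl x ->
  (1 - e) * dl x <= dl z /\ dl z <= (1 + e) * dl x.
Proof.
move=> xz; have : `|dl x - dl z| <= e * dl x.
  by apply: le_trans (dl_lip _ _) _; rewrite ler_wpM2l// distrC.
by rewrite ler_distl => /andP[? ?]; split; lra.
Qed.

(** The total weight received by z comes from points x within dl z / (1 - e) of
z, each of which contributes at most ((1 + e) / (2 dl z))^n. *)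
Lemma integral_kern2 z :
  (\int[leb]_x (kern x z)%:E <= (((1 + e) / (1 - e)) ^+ n)%:E)%E.
Proof.
have e1' : 0 < 1 - e by rewrite subr_gt0.
have := dl0 z; rewrite le_eqVlt => /predU1P[dz|dz].
  rewrite integral0_eq ?lee_fin ?exprn_ge0 ?divr_ge0 ?ltW// ?ltr_wpDr// => x _.
  rewrite /kern; case: ifP => // /kern_comparable[h _].
  have -> : dl x = 0.
    by apply/eqP; rewrite eq_le dl0 andbT -(pmulr_rle0 _ e1') (le_trans h)// -dz.
  by rewrite mulr0 invr0 expr0n.
pose c := (1 + e) / (2 * dl z); pose r := dl z / (1 - e).
have c0 : 0 <= c by rewrite divr_ge0 ?mulr_ge0// addr_ge0.
have r0 : 0 <= r by rewrite divr_ge0// ltW.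
apply: (le_trans (@integral_le_cube R n (kern ^~ z) (c ^+ n) r z r0 _ _ _ _ _)).
- exact: exprn_ge0.
- exact: measurable_kern2.
- by move=> x; exact: kern_ge0.
- move=> x; rewrite /kern; case: ifP => [/kern_comparable[h1 h2]|_];
    last exact: exprn_ge0.
  have dx : 0 < dl x by rewrite -(pmulr_rgt0 _ (x := 1 + e)) ?ltr_wpDr// (lt_le_trans dz).
  apply: lerXn2r; [by rewrite nnegrE invr_ge0 mulr_ge0|by rewrite nnegrE|].
  by rewrite /c -div1r ler_pdivrMr ?mulr_gt0// mulrAC ler_pdivlMr ?mulr_gt0// mul1r; lra.
- move=> x; rewrite distrC /kern => h; case: ifP => // hx.
  have [h1 h2] := kern_comparable hx.
  move: (lt_le_trans h hx); rewrite /r ltr_pdivrMr// => h3.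
  by exfalso; lra.
rewrite lee_fin -exprMn le_eqVlt; apply/orP; left; apply/eqP; congr (_ ^+ _).
by rewrite /c /r; field; rewrite !gt_eqF.
Qed.

Lemma measurable_kernM f : measurable_fun setT f ->
  measurable_fun setT (fun p : V * V => (kern p.1 p.2)%:E * f p.2)%E.
Proof.
move=> mf; apply: emeasurable_funM.
  by apply/measurable_EFinP; exact: measurable_kern.
by apply: (measurableT_comp mf); exact: measurable_snd.
Qed.

Lemma kernM_ge0 f x z : (forall x, 0 <= f x)%E -> (0 <= (kern x z)%:E * f z)%E.
Proof. by move=> f0; rewrite mule_ge0// lee_fin kern_ge0. Qed.

Lemma average_ge0 f x : (forall x, 0 <= f x)%E -> (0 <= average f x)%E.
Proof. by move=> f0; apply: integral_ge0 => z _; exact: kernM_ge0. Qed.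

Lemma measurable_average f : measurable_fun setT f -> (forall x, 0 <= f x)%E ->
  measurable_fun setT (average f).
Proof.
move=> mf f0.
apply: (measurable_fun_fubini_tonelli_F (m2 := leb) _ (measurable_kernM mf)).
by move=> p; exact: kernM_ge0.
Qed.

(** Tonelli, then [integral_kern2]. *)
Lemma integral_average f : measurable_fun setT f -> (forall x, 0 <= f x)%E ->
  (\int[leb]_x average f x <= (((1 + e) / (1 - e)) ^+ n)%:E * \int[leb]_x f x)%E.
Proof.
move=> mf f0.
have K0 : 0 <= ((1 + e) / (1 - e)) ^+ n.
  have ep : 0 <= 1 + e by rewrite addr_ge0.
  have em : 0 <= 1 - e by rewrite subr_ge0 ltW.
  by rewrite exprn_ge0// divr_ge0.
rewrite /average (fubini_tonelli (m1 := leb) (m2 := leb) _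
  (measurable_kernM mf)); last first.
  by move=> p; exact: kernM_ge0.
rewrite -ge0_integralZl ?lee_fin//=.
apply: ge0_le_integral => //=.
- by move=> z _; apply: integral_ge0 => x _; exact: kernM_ge0.
- apply: (measurable_fun_fubini_tonelli_G (m1 := leb) _ (measurable_kernM mf)).
  by move=> p; exact: kernM_ge0.
- exact: measurable_funeM.
move=> z _; rewrite ge0_integralZr//.
- by apply: lee_wpmul2r => //; exact: integral_kern2.
- by apply/measurable_EFinP; exact: measurable_kern2.
- by move=> x _; rewrite lee_fin kern_ge0.
Qed.

Lemma integral_average_pow f : measurable_fun setT f -> (forall x, 0 <= f x)%E ->
  (\int[leb]_x (average f x ^+ n) <=
   (((1 + e) / (1 - e)) ^+ n)%:E * \int[leb]_x (f x ^+ n))%E.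
Proof.
move=> mf f0; have mfn := measurable_fun_expe n mf.
have fn0 x : (0 <= f x ^+ n)%E by exact: expe_ge0.
apply: le_trans (integral_average mfn fn0).
apply: ge0_le_integral => //.
- by move=> x _; apply: expe_ge0; exact: average_ge0.
- by apply: measurable_fun_expe; exact: measurable_average.
- exact: measurable_average.
move=> x _; apply: power_mean => //.
- exact: measurable_kern1.
- exact: kern_ge0.
- exact: integral_kern_le1.
Qed.

(** For fixed y the points x + dl x *: y, with x on a path, form a pushed path: in
this form the average over balls becomes an average over pushed paths. *)
Lemma average_rescaled f x : measurable_fun setT f -> (forall x, 0 <= f x)%E ->
  0 < dl x ->
  average f x = ((2 ^- n)%:E * \int[leb]_(y in cube 0 1%R) f (x + dl x *: y)%R)%E.
Proof.
move=> mf f0 dx.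
have mkf : measurable_fun setT (fun z => (kern x z)%:E * f z)%E.
  by apply: emeasurable_funM => //; apply/measurable_EFinP; exact: measurable_kern1.
rewrite /average (ge0_integral_homothety x dx mkf); last first.
  by move=> z; exact: kernM_ge0.
rewrite [in RHS]integral_mkcond -ge0_integralZl//; last 3 first.
- apply: (measurableT_comp mkf); exact: measurable_homothety.
- by move=> z _; exact: kernM_ge0.
- by rewrite lee_fin exprn_ge0// ltW.
rewrite -ge0_integralZl//; last 2 first.
- apply: (measurable_restrictT _ _).1; first exact: measurable_cube.
  apply: measurable_funTS; apply: (measurableT_comp mf); exact: measurable_homothety.
- by move=> z _; apply: erestrict_ge0.
apply: eq_integral => y _; rewrite /kern addrC addKr normrZ gtr0_norm// ger_pMr//.
rewrite patchE; case: ifPn => y1; last first.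
  by rewrite memNset ?mul0e ?mule0// /cube /= subr0; exact/negP.
rewrite mem_set ?/cube /= ?subr0//.
by rewrite muleA -EFinM -exprMn invfM mulrCA divff ?gt_eqF// mulr1 exprVn.
Qed.

End averaging.

(** * The Euclidean norm *)

Section enorm.
Context {R : realType} {n : nat}.
Implicit Types u v : 'rV[R]_n.

Lemma enorm_ge0 u : 0 <= enorm u.
Proof. exact: sqrtr_ge0. Qed.

Lemma sqr_enorm u : enorm u ^+ 2 = \sum_i u ord0 i ^+ 2.
Proof. by rewrite sqr_sqrtr// sumr_ge0// => i _; exact: sqr_ge0. Qed.

Lemma enorm0 : enorm (0 : 'rV[R]_n) = 0.
Proof.
rewrite /enorm big1 ?sqrtr0// => i _; by rewrite mxE expr0n.
Qed.

Lemma coord_le_enorm u i : `|u ord0 i| <= enorm u.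
Proof.
rewrite -(@ler_pXn2r _ 2)// ?nnegrE ?enorm_ge0// sqr_enorm real_normK ?num_real//.
by rewrite (bigD1 i)//= lerDl sumr_ge0// => j _; exact: sqr_ge0.
Qed.

Lemma enorm_eq0 u : enorm u = 0 -> u = 0.
Proof.
move=> u0; apply/rowP => i; rewrite mxE; apply/eqP; rewrite -normr_eq0.
by rewrite eq_le normr_ge0 andbT -u0 coord_le_enorm.
Qed.

Lemma norm_le_enorm u : `|u| <= enorm u.
Proof.
by apply/(rV_norm_leP _ (enorm_ge0 u)) => i; exact: coord_le_enorm.
Qed.

Lemma enorm_le_norm u : enorm u <= n%:R * `|u|.
Proof.
have h i : `|u ord0 i| <= `|u| by exact: ((rV_norm_leP u (normr_ge0 u)).1 (lexx _)).
rewrite -(@ler_pXn2r _ 2)// ?nnegrE ?enorm_ge0 ?mulr_ge0// sqr_enorm.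
apply: (@le_trans _ _ (\sum_(i < n) `|u| ^+ 2)).
  apply: ler_sum => i _; rewrite -[leLHS]real_normK ?num_real//.
  by rewrite ler_pXn2r ?nnegrE.
rewrite sumr_const card_ord -[leLHS]mulr_natl exprMn ler_wpM2r ?sqr_ge0//.
by rewrite -natrX ler_nat; case: (n) => // k; rewrite expnS leq_pmulr ?expn_gt0.
Qed.

Lemma enormZ a u : enorm (a *: u) = `|a| * enorm u.
Proof.
rewrite /enorm -sqrtr_sqr -sqrtrM ?sqr_ge0// mulr_sumr; congr Num.sqrt.
by apply: eq_bigr => i _; rewrite mxE exprMn.
Qed.

(** Sum the weighted inequalities 2 x y <= (|v| / |u|) x^2 + (|u| / |v|) y^2 over
the coordinates. *)
Lemma cauchy_schwarz u v : \sum_i u ord0 i * v ord0 i <= enorm u * enorm v.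
Proof.
have [u0|u0] := eqVneq (enorm u) 0.
  by rewrite (enorm_eq0 u0) enorm0 mul0r big1// => i _; rewrite mxE mul0r.
have [v0|v0] := eqVneq (enorm v) 0.
  by rewrite (enorm_eq0 v0) enorm0 mulr0 big1// => i _; rewrite mxE mulr0.
have up : 0 < enorm u by rewrite lt_def u0 enorm_ge0.
have vp : 0 < enorm v by rewrite lt_def v0 enorm_ge0.
apply: (@le_trans _ _ (\sum_i (enorm v / (2 * enorm u) * u ord0 i ^+ 2 +
                               enorm u / (2 * enorm v) * v ord0 i ^+ 2))).
  apply: ler_sum => i _; set A := enorm u; set B := enorm v.
  set x := u ord0 i; set y := v ord0 i.
  have : 0 <= (B * x - A * y) ^+ 2 / (2 * A * B).
    by rewrite divr_ge0 ?sqr_ge0// !mulr_ge0// ltW.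
  have -> : (B * x - A * y) ^+ 2 / (2 * A * B) =
    B / (2 * A) * x ^+ 2 + A / (2 * B) * y ^+ 2 - x * y.
    by field; rewrite u0 v0.
  by rewrite subr_ge0.
rewrite big_split/= -!mulr_sumr -!sqr_enorm le_eqVlt; apply/orP; left; apply/eqP.
by field; rewrite u0 v0.
Qed.

Lemma ler_enormD u v : enorm (u + v) <= enorm u + enorm v.
Proof.
rewrite -(@ler_pXn2r _ 2)// ?nnegrE ?addr_ge0 ?enorm_ge0// sqrrD !sqr_enorm.
under eq_bigr do rewrite mxE sqrrD.
rewrite !big_split/= lerD2r lerD2l mulr2n; by apply: lerD;
  exact: cauchy_schwarz.
Qed.

Lemma enorm_le_sum u : enorm u <= \sum_i `|u ord0 i|.
Proof.
rewrite -(@ler_pXn2r _ 2)// ?nnegrE ?enorm_ge0 ?sumr_ge0// sqr_enorm.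
rewrite expr2 mulr_suml; apply: ler_sum => i _.
rewrite -[leLHS]real_normK ?num_real// expr2 ler_wpM2l//.
by rewrite (bigD1 i)//= lerDl sumr_ge0.
Qed.

End enorm.

(** * Length and arclength *)

Section length.
Context {R : realType} {n : nat}.
Implicit Types (f : R -> 'rV[R]_n) (a b c t : R) (s : seq R).

Lemma polygonal_length_nil f a b : polygonal_length f a b [::] = 0.
Proof. by rewrite /polygonal_length big_nil. Qed.

Lemma polygonal_length_cons f a b x s :
  polygonal_length f a b (x :: s) =
  enorm (f x - f a) + polygonal_length f x b s.
Proof. by rewrite /polygonal_length/= big_nat_recl. Qed.

Lemma polygonal_length_rcons f a c b s : itv_partition a c s ->
  polygonal_length f a b (rcons s b) =
  polygonal_length f a c s + enorm (f b - f c).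
Proof.
elim: s a => [|x s IH] a.
  by move=> /itv_partition_nil ->; rewrite /= polygonal_length_cons
    !polygonal_length_nil addrC.
move=> /itv_partition_cons /IH {}IH.
by rewrite rcons_cons !polygonal_length_cons IH addrA.
Qed.

(** [length_upto g] is [path_length g (cstart g)]; a variable starting point
allows induction along partitions. *)
Definition path_length f a t : \bar R :=
  ereal_sup [set (polygonal_length f a t s)%:E | s in itv_partition a t].

Lemma path_length_ub f a t s : itv_partition a t s ->
  ((polygonal_length f a t s)%:E <= path_length f a t)%E.
Proof. by move=> ats; apply: ereal_sup_ubound; exists s. Qed.

Lemma path_lengthxx f a : path_length f a a = 0%E.
Proof.
apply/eqP; rewrite eq_le; apply/andP; split.
  apply: ge_ereal_sup => _ [s /itv_partitionxx -> <-].
  by rewrite polygonal_length_nil.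
have := @path_length_ub f a a [::]; rewrite polygonal_length_nil; apply.
by split => /=.
Qed.

Lemma path_length_chord f a c b : c <= b ->
  (path_length f a c + (enorm (f b - f c))%:E <= path_length f a b)%E.
Proof.
rewrite le_eqVlt => /predU1P[->|cb]; first by rewrite subrr enorm0 adde0.
rewrite -leeBrDr//; apply: ge_ereal_sup => _ [s acs <-].
rewrite leeBrDr// -EFinD -polygonal_length_rcons//; apply: path_length_ub.
rewrite -cats1; apply: itv_partition_cat acs _; exact: itv_partition1.
Qed.

Lemma path_length_ge0 f a b : a <= b -> (0 <= path_length f a b)%E.
Proof.
move=> ab; apply: le_trans (path_length_chord f a ab).
by rewrite path_lengthxx add0e lee_fin enorm_ge0.
Qed.

(** The length function grows no faster than any function P that controls the
chords.  It is applied to linear P for Lipschitz paths, and to a sum of total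
variations for rectifiable curves, from whose continuity that of length
follows.  The partition of [a, b] is split at c by induction. *)
Lemma path_length_control f (P : R -> R) a c b : a <= c -> c <= b ->
  (forall x y, a <= x -> x <= y -> y <= b -> enorm (f y - f x) <= P y - P x) ->
  (path_length f a b <= path_length f a c + (P b - P c)%:E)%E.
Proof.
move=> ac cb fP; apply: ge_ereal_sup => _ [s abs <-].
elim: s a ac fP abs => [|x s IH] a ac fP abs.
  have ab := itv_partition_nil abs.
  have cb' : c = b by apply/eqP; rewrite eq_le cb -ab ac.
  rewrite polygonal_length_nil cb' subrr adde0 path_length_ge0//.
  by rewrite ab.
have ax : a < x by case: abs => /= /andP[].
have xbs := itv_partition_cons abs.
have xb := itv_partition_le xbs.
rewrite polygonal_length_cons EFinD.
(* If x <= c the split point is still ahead; otherwise it lies in [a, x]. *)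
have [xc|cx] := leP x c.
  apply: (@le_trans _ _ ((enorm (f x - f a))%:E + (path_length f x c +
    (P b - P c)%:E))%E).
    rewrite leeD2l//; apply: IH => // y z xy yz zb.
    by apply: fP => //; rewrite (le_trans (ltW ax)).
  rewrite addeA leeD2r//.
  rewrite addeC -leeBrDr//; apply: ge_ereal_sup => _ [t xct <-].
  rewrite leeBrDr// -EFinD addrC -polygonal_length_cons; apply: path_length_ub.
  by rewrite -cat1s; apply: itv_partition_cat xct; exact: itv_partition1.
have sP u x' : itv_partition x' b u -> a <= x' -> polygonal_length f x' b u <= P b - P x'.
  elim: u x' => [|z u IHu] x' /=.
    by move=> /itv_partition_nil ->; rewrite polygonal_length_nil subrr.
  move=> h ax'; have x'z : x' < z by case: h => /= /andP[].
  have zbu := itv_partition_cons h.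
  have := IHu _ zbu (le_trans ax' (ltW x'z)).
  have := fP _ _ ax' (ltW x'z) (itv_partition_le zbu).
  by rewrite polygonal_length_cons; lra.
have h1 := sP _ _ xbs (ltW ax).
have h2 := fP _ _ ac (ltW cx) xb.
have h3 := path_length_chord f a ac; rewrite path_lengthxx add0e in h3.
have h4 : enorm (f x - f a) <= enorm (f x - f c) + enorm (f c - f a).
  by rewrite -(subrKA (f c)); exact: ler_enormD.
apply: le_trans (leeD2r _ h3); rewrite -!EFinD lee_fin; lra.
Qed.

End length.

Section arclength.
Context {R : realType} {n : nat}.

(** A nondecreasing function l controlled by a continuous P takes the value s at
the infimum of {s <= l}: if l jumped over s there, the intermediate value
theorem for P would give a point d on the wrong side of that infimum. *)
Lemma inf_level_set (a b : R) (l P : R -> R) (s : R) : a <= b ->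
  {within `[a, b], continuous P} ->
  (forall x y, a <= x -> x <= y -> y <= b -> 0 <= l y - l x <= P y - P x) ->
  l a <= s <= l b ->
  let t := inf [set t | t \in `[a, b] /\ s <= l t] in
  t \in `[a, b] /\ l t = s.
Proof.
move=> ab cP lP /andP[las slb] t.
set S := [set t | _] in t *.
have Sb : S b by split => //; rewrite in_itv/= ab lexx.
have lbS : lbound S a by move=> x [/[!in_itv]/= /andP[]].
have hS : has_inf S by split; [exists b|exists a].
have at_ : a <= t by apply: lb_le_inf => //; exists b.
have tb : t <= b by apply: ge_inf => //; exists a.
split; first by rewrite in_itv/= at_ tb.
have nd x y : a <= x -> x <= y -> y <= b -> P x <= P y.
  by move=> ax xy yb; have /andP[h1 h2] := lP _ _ ax xy yb;
    rewrite -subr_ge0 (le_trans h1).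
have PIVT v : P a <= v -> v <= P b -> exists2 c, c \in `[a, b] & P c = v.
  move=> av vb; apply: IVT => //; rewrite ge_min le_max av vb orbT//.
apply/eqP; rewrite eq_le; apply/andP; split; rewrite leNgt; apply/negP => h.
  (* Here l d > s with d < t, so d is in S below its infimum. *)
  have [d dab Pd] : exists2 d, d \in `[a, b] & P d = P t - (l t - s) / 2.
    have /andP[h1 h2] := lP _ _ (lexx a) at_ tb.
    have := nd _ _ at_ tb (lexx b).
    by move=> h3; apply: PIVT; lra.
  move: dab; rewrite in_itv/= => /andP[ad db].
  have dt : d < t by rewrite ltNge; apply/negP => /(fun h => nd _ _ at_ h db); lra.
  have Sd : S d.
    split; first by rewrite in_itv/= ad db.
    by have /andP[_] := lP _ _ ad (ltW dt) tb; lra.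
  have : t <= d by apply: ge_inf => //; exists a.
  by rewrite leNgt dt.
(* Here l d < s with t < d, so d is a lower bound of S above its infimum. *)
have [d dab Pd] : exists2 d, d \in `[a, b] & P d = P t + (s - l t) / 2.
  have /andP[h1 h2] := lP _ _ at_ tb (lexx b).
  have := nd _ _ (lexx a) at_ tb.
  by move=> h3; apply: PIVT; lra.
move: dab; rewrite in_itv/= => /andP[ad db].
have td : t < d by rewrite ltNge; apply/negP => /(fun h => nd _ _ ad h tb); lra.
have : d <= t.
  apply: lb_le_inf; first by exists b.
  move=> x [/[!in_itv]/= /andP[ax xb] sx]; rewrite leNgt; apply/negP => xd.
  have /andP[h1 _] := lP _ _ ax (ltW xd) db.
  by have /andP[_ h2] := lP _ _ at_ (ltW td) db; lra.
by rewrite leNgt td.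
Qed.

(** The coordinates of a rectifiable curve are continuous of bounded variation,
and the total variation of such a function is continuous. *)
Lemma rectifiable_control (g : curve R n) : rectifiable g ->
  exists P : R -> R, {within `[cstart g, cend g], continuous P} /\
  forall x y, cstart g <= x -> x <= y -> y <= cend g ->
    enorm (g y - g x) <= P y - P x.
Proof.
move=> rg; set a := cstart g; set b := cend g.
have ab : a <= b := cstart_le_cend g.
pose gi (i : 'I_n) t := g t ord0 i.
have Lfin : curve_length g \is a fin_num.
  by rewrite ge0_fin_numE// path_length_ge0.
have bv i : bounded_variation a b (gi i).
  exists (fine (curve_length g)) => _ [s abs <-].
  rewrite -lee_fin fineK//; apply: le_trans (path_length_ub g abs).
  rewrite lee_fin; apply: ler_sum => k _ /=.
  have := coord_le_enorm (g (nth b (a :: s) k.+1) - g (nth b (a :: s) k)) i.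
  by rewrite !mxE.
have cgi i : {within `[a, b], continuous (gi i)}.
  move=> x.
  have cx : {for g x, continuous (fun v : 'rV[R]_n => v ord0 i)}.
    exact: coord_continuous.
  exact: (continuous_comp (@curve_continuous R n g x) cx).
pose P t := \sum_(i < n) fine (total_variation a t (gi i)).
exists P; split.
  move: ab; rewrite le_eqVlt => /predU1P[ab|ab].
    by rewrite -ab set_itv1; exact: continuous_subspace1.
  pose Q r t := \sum_(i <- r) fine (total_variation a t (gi i)).
  suff cQ r : {within `[a, b], continuous (Q r)} by exact: cQ.
  elim: r => [|i r IHr].
    have -> : Q [::] = cst 0 by apply/funext => t; rewrite /Q big_nil.
    by move=> x; exact: cvg_cst.
  have -> : Q (i :: r) = (fine \o (total_variation a)^~ (gi i)) \+ Q r.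
    by apply/funext => t; rewrite /Q big_cons.
  by move=> x; apply: continuousD; [exact: (total_variation_continuous ab)|exact: IHr].
move=> x y ax xy yb; apply: le_trans (enorm_le_sum _) _.
rewrite /P -sumrB; apply: ler_sum => i _.
have fin z : a <= z -> z <= b -> total_variation a z (gi i) \is a fin_num.
  move=> az zb; apply/bounded_variationP => //.
  by apply: (bounded_variationl az zb).
have ay := le_trans ax xy; have xb := le_trans xy yb.
have TD := total_variationD (gi i) ax xy.
have := total_variation_ge (gi i) xy.
rewrite lerBrDr -lee_fin EFinD !fineK ?fin// TD addeC !mxE.
by move=> h; rewrite leeD2l.
Qed.

End arclength.

Section arclength_param.
Context {R : realType} {n : nat}.
Variable g : curve R n.
Hypothesis rg : rectifiable g.
Local Notation a := (cstart g).
Local Notation b := (cend g).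
Local Notation L := (fine (curve_length g)).

Definition len (t : R) : R := fine (length_upto g t).

Definition arclength_time (s : R) : R :=
  inf [set t | t \in `[a, b] /\ (s%:E <= length_upto g t)%E].

Lemma length_upto_fin t : a <= t -> t <= b -> length_upto g t \is a fin_num.
Proof.
move=> at_ tb; rewrite ge0_fin_numE; last exact: path_length_ge0.
apply: le_lt_trans rg; apply: le_trans (path_length_chord g a tb).
by rewrite leeDl// lee_fin enorm_ge0.
Qed.

Lemma lenE t : a <= t -> t <= b -> (len t)%:E = length_upto g t.
Proof. by move=> at_ tb; rewrite fineK// length_upto_fin. Qed.

Lemma len_start : len a = 0.
Proof. by rewrite /len /length_upto -/(path_length g a a) path_lengthxx. Qed.

Lemma enorm_le_len x y : a <= x -> x <= y -> y <= b ->
  enorm (g y - g x) <= len y - len x.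
Proof.
move=> ax xy yb; have := path_length_chord g a xy.
rewrite -[path_length _ _ x]lenE ?(le_trans xy)//.
rewrite -[path_length _ _ y]lenE ?(le_trans ax)//.
by rewrite -EFinD lee_fin; lra.
Qed.

Lemma len_le P x y : (forall x y, a <= x -> x <= y -> y <= b ->
    enorm (g y - g x) <= P y - P x) ->
  a <= x -> x <= y -> y <= b -> len y - len x <= P y - P x.
Proof.
move=> gP ax xy yb.
have := @path_length_control _ _ g P _ _ _ ax xy.
rewrite -[path_length _ _ x]lenE ?(le_trans xy)//.
rewrite -[path_length _ _ y]lenE ?(le_trans ax)//.
rewrite -EFinD lee_fin -lerBlDl; apply => u v au uv vy.
by apply: gP => //; exact: le_trans yb.
Qed.

Lemma len_nd x y : a <= x -> x <= y -> y <= b -> len x <= len y.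
Proof.
move=> ax xy yb; rewrite -subr_ge0; apply: le_trans (enorm_le_len ax xy yb).
exact: enorm_ge0.
Qed.

Lemma fine_curve_length_ge0 : 0 <= L.
Proof. by rewrite fine_ge0// path_length_ge0// cstart_le_cend. Qed.

Lemma arclength_timeP s : 0 <= s -> s <= L ->
  arclength_time s \in `[a, b] /\ len (arclength_time s) = s.
Proof.
move=> s0 sL; have [P [cP gP]] := rectifiable_control rg.
rewrite /arclength_time (_ : [set t | _] = [set t | t \in `[a, b] /\ s <= len t]).
  apply: (inf_level_set (P := P)) => //.
  - exact: cstart_le_cend.
  - move=> x y ax xy yb; rewrite (len_le gP ax xy yb) andbT.
    by rewrite subr_ge0 len_nd.
  - by rewrite len_start s0.
apply/seteqP; split => t [tab st]; split => //; move: (tab) st;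
  by rewrite in_itv/= => /andP[at_ tb]; rewrite -lenE// lee_fin.
Qed.

Lemma arclength_time_nd s s' : 0 <= s -> s <= s' -> s' <= L ->
  arclength_time s <= arclength_time s'.
Proof.
move=> s0 ss' sL; have [tab ts] := arclength_timeP (le_trans s0 ss') sL.
apply: ge_inf; first by exists a => t [] /[!in_itv]/= /andP[].
split => //; rewrite -lenE; [by rewrite ts lee_fin| | ];
  by move: tab; rewrite in_itv/= => /andP[].
Qed.

(** The chord between two times is at most the length in between. *)
Lemma arclength_param_lip s s' : 0 <= s -> s <= s' -> s' <= L ->
  enorm (arclength_param g s' - arclength_param g s) <= s' - s.
Proof.
move=> s0 ss' sL; have tt' := arclength_time_nd s0 ss' sL.
have [] := arclength_timeP (le_trans s0 ss') sL.
have [] := arclength_timeP s0 (le_trans ss' sL).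
rewrite !in_itv/= => /andP[h1 h2] h3 /andP[h4 h5] h6.
by have := enorm_le_len h1 tt' h5; rewrite h3 h6.
Qed.

Lemma arclength_param0 : arclength_param g 0 = g a.
Proof.
have [] := arclength_timeP (lexx _) fine_curve_length_ge0.
rewrite in_itv/= => /andP[h1 h2] h3.
have := enorm_le_len (lexx a) h1 h2; rewrite h3 len_start subrr => h.
by apply/eqP; rewrite -subr_eq0; apply/eqP/enorm_eq0/le_anti; rewrite h enorm_ge0.
Qed.

Lemma arclength_paramL : arclength_param g L = g b.
Proof.
have [] := arclength_timeP fine_curve_length_ge0 (lexx _).
rewrite in_itv/= => /andP[h1 h2] h3.
have := enorm_le_len h1 h2 (lexx b); rewrite h3 subrr => h.
apply/esym/eqP; rewrite -subr_eq0; apply/eqP/enorm_eq0/le_anti.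
by rewrite h enorm_ge0.
Qed.

End arclength_param.

(** * Line integrals along Lipschitz curves *)

Section lipschitz_line_integral.
Context {R : realType} {n : nat}.
Variables (g : curve R n) (K : R).
Local Notation a := (cstart g).
Local Notation b := (cend g).
Local Notation L := (fine (curve_length g)).
Hypothesis Kp : 0 < K.
Let K0 : 0 <= K := ltW Kp.
Hypothesis gK : forall x y, a <= x -> x <= y -> y <= b ->
  enorm (g y - g x) <= K * (y - x).

Let gP x y : a <= x -> x <= y -> y <= b ->
  enorm (g y - g x) <= K * y - K * x.
Proof. by move=> ax xy yb; rewrite -mulrBr gK. Qed.

Lemma lipschitz_rectifiable : rectifiable g.
Proof.
have ab := cstart_le_cend g.
have := path_length_control (lexx a) ab gP.
rewrite path_lengthxx add0e => h; apply: le_lt_trans h _.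
by rewrite ltry.
Qed.

Let rg := lipschitz_rectifiable.

Definition clamp (u v x : R) : R := Num.max u (Num.min v x).

Lemma clamp_id u v x : u <= x -> x <= v -> clamp u v x = x.
Proof. by move=> ux xv; rewrite /clamp min_r// max_r. Qed.

Lemma clamp_ge u v x : u <= clamp u v x.
Proof. by rewrite /clamp le_max lexx. Qed.

Lemma clamp_le u v x : u <= v -> clamp u v x <= v.
Proof. by move=> uv; rewrite /clamp ge_max uv ge_min lexx. Qed.

Lemma clamp_nd u v : {homo clamp u v : x y / x <= y}.
Proof. by move=> x y xy; apply: le_max2 => //; exact: le_min2. Qed.

Lemma clamp_lip (u v s t : R) : s <= t -> clamp u v t - clamp u v s <= t - s.
Proof.
move=> st; rewrite /clamp; case: (leP v t) => ?; case: (leP v s) => ?;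
  case: (leP u v) => ?; case: (leP u s) => ?; case: (leP u t) => ?; lra.
Qed.

Let tau u := arclength_time g (clamp 0 L u).

Let tauP u : [/\ a <= tau u, tau u <= b & len g (tau u) = clamp 0 L u].
Proof.
have [] := arclength_timeP rg (clamp_ge 0 L u) (clamp_le u (fine_curve_length_ge0 g)).
by rewrite in_itv/= => /andP[].
Qed.

Let tau_measurable : @measurable_fun _ _ (measurableTypeR R) (measurableTypeR R) setT tau.
Proof.
apply: nondecreasing_measurable => // u v uv; apply: arclength_time_nd => //.
- exact: clamp_ge.
- exact: clamp_nd.
- by apply: clamp_le; exact: fine_curve_length_ge0.
Qed.

Let mD : measurable (`[0, L]%classic : set R).
Proof. by []. Qed.

Let nu := measure_function_pushforward__canonical__measure_function_Measure
  (measure_function_mrestr__canonical__measure_function_Measure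
     (@lebesgue_measure R) mD) tau_measurable.

Let nuE S : nu S = lebesgue_measure (tau @^-1` S `&` `[0, L]%classic).
Proof. by []. Qed.

(** The parameters in ]c, d[ are visited over a set of arclengths of size at most
the length of g on [c, d], hence at most K * (d - c). *)
Let nu_itv c d : c <= d -> (nu `]c, d[%classic <= (K * (d - c))%:E)%E.
Proof.
move=> cd; rewrite nuE; set S := (_ `&` _).
have Slen u : S u -> [/\ c < tau u, tau u < d & len g (tau u) = u].
  move=> [/= /[!in_itv]/= /andP[-> ->] /andP[u0 uL]]; split => //.
  by have [_ _ ->] := tauP u; rewrite clamp_id.
have [[u0 Su0]|S0] := pselect (S !=set0); last first.
  rewrite [X in lebesgue_measure X](_ : _ = set0) ?measure0 ?lee_fin
    ?mulr_ge0 ?subr_ge0//.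
  by apply/seteqP; split => // u Su; case: S0; exists u.
pose c' := Num.max a c; pose d' := Num.min b d.
have [cu ud _] := Slen _ Su0; have [au ub _] := tauP u0.
have ac : a <= c' by rewrite /c' le_max lexx.
have db : d' <= b by rewrite /d' ge_min lexx.
have cd' : c' <= d'.
  by rewrite /c' /d' ge_max !le_min (le_trans au ub) (le_trans au (ltW ud))
    (le_trans (ltW cu) ub) cd.
apply: (@le_trans _ _ (lebesgue_measure `[len g c', len g d']%classic)).
  apply: le_measure; rewrite ?inE//.
    by apply: measurableI => //; rewrite -[X in measurable X]setTI; exact: tau_measurable.
  move=> u Su /=; rewrite in_itv/=; have [cu1 ud1 <-] := Slen _ Su.
  have [au1 ub1 _] := tauP u.
  rewrite !len_nd// ?/c' ?/d' ?ge_max ?le_min ?au1 ?ub1 ?(ltW cu1) ?(ltW ud1)//.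
have h := len_le rg gP ac cd' db.
have := len_nd rg ac cd' db.
rewrite lebesgue_measure_itv/= lte_fin le_eqVlt => /predU1P[->|lt].
  by rewrite ltxx lee_fin mulr_ge0// subr_ge0.
rewrite lt -EFinB lee_fin (le_trans h)// -mulrBr ler_wpM2l//.
have : d' <= d by rewrite /d' ge_min lexx orbT.
have : c <= c' by rewrite /c' le_max lexx orbT.
lra.
Qed.

(** Lebesgue measure being computed by covers by open intervals, the bound on
intervals passes to measurable sets. *)
Let nu_le S : measurable S -> (nu S <= K%:E * lebesgue_measure S)%E.
Proof.
move=> mS.
have -> : lebesgue_measure S = ereal_inf
    [set (\sum_(0 <= k <oo) wlength idfun (F k))%E | F in open_itv_cover S].
  exact: outer_measure_open_itv_cover.
rewrite -lee_pdivrMl//.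
apply/ereal_infP => _ [F [itvF SF] <-].
rewrite lee_pdivrMl// -nneseriesZl; last first.
  by move=> i _; exact: wlength_ge0.
apply: (@le_trans _ _ (\sum_(0 <= k <oo) nu (F k))%E).
  apply: measure_sigma_subadditive => // k.
  by have [[c d] ->] := itvF k.
apply: lee_nneseries => // k _; have [[c d] /= ->] := itvF k.
rewrite wlength_itv/= lte_fin; have [cd|dc] := ltP c d.
  by rewrite -EFinM; exact: nu_itv (ltW cd).
rewrite mule0 (_ : `]c, d[%classic = set0) ?measure0//.
by rewrite set_itv_ge// bnd_simp -leNgt.
Qed.

(** Change of variables with inequality: the arclength integral is an integral
for the image nu of Lebesgue measure under the arclength inverse, and nu is at
most K times Lebesgue measure. *)
Lemma line_integral_lipschitz (f : 'rV[R]_n -> \bar R) :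
  measurable_fun setT g -> measurable_fun setT f -> (forall x, 0 <= f x)%E ->
  (line_integral g f <=
   K%:E * \int[lebesgue_measure]_(t in `[a, b]%classic) f (g t))%E.
Proof.
move=> mg mf f0.
pose F := (fun t => f (g t)) \_ `[a, b]%classic.
have F0 t : (0 <= F t)%E by exact: erestrict_ge0.
have mF : @measurable_fun _ _ (measurableTypeR R) _ setT F.
  apply: (measurable_restrictT _ _).1 => //; apply: measurable_funTS.
  exact: measurableT_comp.
have KE : (K%:E * \int[lebesgue_measure]_(t in `[a, b]%classic) f (g t))%E =
    (\int[mscale (NngNum K0) (@lebesgue_measure R)]_t F t)%E.
  by rewrite ge0_integral_mscale//= -integral_mkcond.
rewrite KE; apply: (@le_trans _ _ (\int[nu]_t F t)%E); last first.
  have h S : measurable S -> (nu S <= mscale (NngNum K0) (@lebesgue_measure R) S)%E.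
    by move=> mS; exact: nu_le.
  exact: (ge0_le_measure_integral h measurableT F0 mF).
rewrite (ge0_integral_pushforward tau_measurable)// preimage_setT.
have mFt : measurable_fun setT (F \o tau) by exact: measurableT_comp.
apply: (@le_trans _ _ (\int[measure_function_mrestr__canonical__measure_function_Measure
     (@lebesgue_measure R) mD]_(u in `[0%R, L]%classic) (F \o tau) u)%E); last first.
  by apply: ge0_subset_integral => // u _; exact: F0.
rewrite (eq_measure_integral (@lebesgue_measure R)); last first.
  by move=> A mA AD; rewrite /= /mrestr setIidl.
rewrite /line_integral le_eqVlt; apply/orP; left; apply/eqP.
apply: eq_integral => u; rewrite inE/= in_itv/= => /andP[u0 uL].
have [au ub _] := tauP u; rewrite /F patchE mem_set; last by rewrite /= in_itv/= au.
by rewrite /arclength_param -/(arclength_time g u) /tau clamp_id.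
Qed.

End lipschitz_line_integral.

(** * Translates of a path that meet a set of small Hausdorff measure *)

Section hausdorff_null.
Context {R : realType} {n : nat}.

(** Each d i ^+ m exceeds the gauge of U i by a term of a geometric series, so
that d i is positive even when U i is a point. *)
Lemma hausdorff_null_cover (m : nat) (E : set 'rV[R]_n) (eta : R) :
  (0 < m)%N -> hausdorff_measure (m%:R : R) E = 0%E -> 0 < eta ->
  exists (U : nat -> set 'rV[R]_n) (d : nat -> R),
    [/\ E `<=` \bigcup_i U i, forall i, 0 < d i,
        forall i p q, U i p -> U i q -> enorm (p - q) <= d i &
        (\sum_(0 <= i <oo) (d i ^+ m)%:E <= eta%:E)%E].
Proof.
move=> m0 E0 eta0; have e20 : 0 < eta / 2 by rewrite divr_gt0.
have mR : (m%:R : R) != 0 by rewrite pnatr_eq0 -lt0n.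
have : (hausdorff_content m%:R 1 E < (eta / 2)%:E)%E.
  apply: (@le_lt_trans _ _ 0%E); last by rewrite lte_fin.
  by rewrite -E0; apply: ereal_sup_ubound; exists 1 => //=; rewrite ltr01.
move=> /ereal_inf_lt[_ [U [EU _] <-]] sumU.
have g0 i : (0 <= hausdorff_gauge m%:R (U i))%E.
  by rewrite /hausdorff_gauge; case: ifP => // _; exact: poweR_ge0.
have gfin i : hausdorff_gauge m%:R (U i) \is a fin_num.
  rewrite ge0_fin_numE//; apply: le_lt_trans (lt_trans sumU (ltry _)).
  rewrite (nneseriesD1 (n := i))//.
  by rewrite leeDl// nneseries_ge0.
pose G i : R := fine (hausdorff_gauge m%:R (U i)) + eta / 2 / (2 ^ i.+1)%:R.
have G0 i : 0 < G i.
  by rewrite ltr_wpDl ?fine_ge0// divr_gt0// ltr0n expn_gt0.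
pose d i : R := G i `^ m%:R^-1.
have d0 i : 0 < d i by exact: powR_gt0.
have dm i : d i ^+ m = G i.
  by rewrite -powR_mulrn ?ltW// -powRrM mulVf// powRr1// ltW.
exists U, d; split => //.
- move=> i p q Up Uq.
  have h : (((enorm (p - q)) `^ m%:R)%:E <= hausdorff_gauge m%:R (U i))%E.
    rewrite /hausdorff_gauge; case: ifPn => [/eqP U0|_].
      by move: Up; rewrite U0.
    have pq : ((enorm (p - q))%:E <= ediam (U i))%E.
      by apply: ereal_sup_ubound; exists (p, q).
    rewrite -poweR_EFin; apply: gt0_ler_poweR => //.
      by rewrite in_itv/= lee_fin enorm_ge0 leey.
    by rewrite in_itv/= leey andbT (le_trans _ pq)// lee_fin enorm_ge0.
  rewrite -(@ler_pXn2r _ m) ?nnegrE ?enorm_ge0 ?(ltW (d0 _))// dm.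
  rewrite -powR_mulrn ?enorm_ge0//.
  apply: (@le_trans _ _ (fine (hausdorff_gauge m%:R (U i)))).
    by rewrite -lee_fin fineK.
  by rewrite lerDl divr_ge0// ltW.
under eq_eseriesr do rewrite dm EFinD fineK//.
apply: (le_trans (epsilon_trick _ _ _)) => //; first exact: ltW.
by rewrite [in leRHS](splitr eta) EFinD leeD2r// ltW.
Qed.

End hausdorff_null.

Section bad_translates.
Context {R : realType} {m : nat}.
Local Notation n := m.+1.
Local Notation V := 'rV[R]_n.
Local Notation leb := (@lebesgue_rV R n).
Variables (dl : V -> R) (e : R) (h : R -> V) (E : set V) (s1 s2 : R).
Hypotheses (m0 : (0 < m)%N) (e1 : e <= 1).
Hypothesis dl_lip : forall x z, `|dl x - dl z| <= e * `|x - z|.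
Hypothesis h_lip : forall s t, `|h s - h t| <= `|s - t|.
Hypothesis E0 : hausdorff_measure (m%:R : R) E = 0%E.
Hypothesis s12 : s1 <= s2.

Lemma finite_cover_measure (A : nat -> set V) (q : R) (J : nat) : 0 <= q ->
  (forall j, exists Q, [/\ measurable Q, A j `<=` Q & (leb Q <= q%:E)%E]) ->
  exists M, [/\ measurable M, (forall j, (j < J)%N -> A j `<=` M) &
    (leb M <= (J%:R * q)%:E)%E].
Proof.
move=> q0 AQ; elim: J => [|J [M [mM AM lM]]].
  by exists set0; split => //; rewrite measure0 mul0r.
have [Q [mQ AQ' lQ]] := AQ J.
exists (M `|` Q); split.
- exact: measurableU.
- move=> j; rewrite ltnS leq_eqVlt => /predU1P[->|jJ] x Ax.
    by right; exact: AQ'.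
  by left; exact: (AM j).
apply: (le_trans (measureU2 _ mM mQ)).
by rewrite -natr1 mulrDl mul1r EFinD leeD.
Qed.

(** If y at time s and y' at time s' both lead into U, then
dl (h s) *: (y - y') differs from a chord of U by terms of size |s - s'|. *)
Lemma hitting_set_diam (c d : R) (U : set V) (y y' : V) (s s' : R) :
  0 < c -> (forall p q, U p -> U q -> enorm (p - q) <= d) ->
  `|y'| <= 1 -> c <= dl (h s) -> `|s - s'| <= d ->
  U (h s + dl (h s) *: y) -> U (h s' + dl (h s') *: y') ->
  `|y - y'| <= 3 * d / c.
Proof.
move=> c0 Ud y1 cs ss' Us Us'.
have hh : `|h s - h s'| <= d by exact: le_trans (h_lip _ _) ss'.
have dd : `|dl (h s) - dl (h s')| <= d.
  by apply: le_trans (dl_lip _ _) _; rewrite (le_trans _ hh)// ler_piMl.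
have ds : 0 < dl (h s) by exact: lt_le_trans cs.
have key : dl (h s) *: (y - y') =
    (h s + dl (h s) *: y - (h s' + dl (h s') *: y')) - (h s - h s')
    - (dl (h s) - dl (h s')) *: y'.
  by apply/rowP => i; rewrite !mxE; ring.
have : `|dl (h s) *: (y - y')| <= 3 * d.
  rewrite key; apply: le_trans (ler_normB _ _) _.
  have -> : 3 * d = d + d + d by ring.
  apply: lerD; last first.
    by rewrite normrZ (le_trans _ dd)// ler_piMr.
  apply: le_trans (ler_normB _ _) _; apply: lerD => //.
  by apply: le_trans (norm_le_enorm _) _; exact: Ud.
rewrite normrZ gtr0_norm// => h3.
rewrite ler_pdivlMr// mulrC (le_trans _ h3)// ler_wpM2r//.
Qed.

(** The pushed path degenerates where dl vanishes; the bound dl >= c keeps away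
from there, and c tends to 0 in [hitting_negligible]. *)
Definition far_hitting_set (c : R) : set V :=
  [set y | `|y| <= 1 /\ exists s, [/\ s1 <= s, s <= s2, c <= dl (h s) &
     E (h s + dl (h s) *: y)]].

(** Cut [s1, s2] into about (s2 - s1) / d i pieces of length d i.  The vectors y
that lead into U i during one piece lie in a ball of radius comparable to d i,
so those that lead into U i at all have measure at most a constant times
(1 / d i) * (d i)^n = (d i)^m, whose sum over i is small. *)
Lemma far_hitting_set_cover (c eta : R) : 0 < c -> 0 < eta ->
  exists M, [/\ measurable M, far_hitting_set c `<=` M & (leb M <= eta%:E)%E].
Proof.
move=> c0 eta0.
pose T := s2 - s1; have T0 : 0 <= T by rewrite subr_ge0.
pose C := (6 / c) ^+ n * (T + 1).
have C0 : 0 < C by rewrite mulr_gt0 ?exprn_gt0 ?divr_gt0// ltr_wpDl.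
(* The bound by 1 makes every d i at most 1. *)
pose eta' := Num.min 1 (eta / C).
have eta'0 : 0 < eta' by rewrite lt_min ltr01 divr_gt0.
have [U [d [EU d0 Ud sumd]]] := hausdorff_null_cover m0 E0 eta'0.
have d1 i : d i <= 1.
  rewrite -(@ler_pXn2r _ m) ?nnegrE ?(ltW (d0 _))// expr1n -lee_fin.
  apply: (@le_trans _ _ eta'%:E); last by rewrite lee_fin ge_min lexx.
  apply: le_trans sumd; rewrite (nneseriesD1 (n := i))//; last first.
    by move=> k _; rewrite lee_fin exprn_ge0// ltW.
  rewrite leeDl// nneseries_ge0// => k _ _.
  by rewrite lee_fin exprn_ge0// ltW.
have coverU i : exists M, [/\ measurable M,
    (forall y s, `|y| <= 1 -> s1 <= s -> s <= s2 -> c <= dl (h s) ->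
       U i (h s + dl (h s) *: y) -> M y) & (leb M <= (C * d i ^+ m)%:E)%E].
  pose A j : set V := [set y | `|y| <= 1 /\ exists s, [/\ s1 + j%:R * d i <= s,
     s <= s1 + j.+1%:R * d i, c <= dl (h s) & U i (h s + dl (h s) *: y)]].
  have r0 : 0 <= 3 * d i / c by rewrite divr_ge0 ?mulr_ge0 ?ltW.
  pose q := (2 * (3 * d i / c)) ^+ n.
  have q0 : 0 <= q by rewrite exprn_ge0// mulr_ge0.
  have AQ j : exists Q, [/\ measurable Q, A j `<=` Q & (leb Q <= q%:E)%E].
    have [[y' [y'1 [s' [js' s'j cs' Us']]]]|A0] := pselect (A j !=set0).
      exists (cube y' (3 * d i / c)); split.
      - exact: measurable_cube.
      - move=> y [y1 [s [js sj cs Us]]].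
        apply: (hitting_set_diam c0 (Ud i) y'1 cs _ Us Us').
        rewrite ler_norml; move: js sj js' s'j; rewrite -natr1 mulrDl mul1r.
        by move=> *; apply/andP; split; lra.
      - by rewrite (lebesgue_cube _ r0).
    exists set0; split => //.
      by move=> y Ay; case: A0; exists y.
    by rewrite measure0 lee_fin.
  pose J := (Num.truncn (T / d i)).+1.
  have [M [mM AM lM]] := finite_cover_measure J q0 AQ.
  exists M; split => //.
    move=> y s y1 ss1 ss2 cs Us.
    pose j := Num.truncn ((s - s1) / d i).
    have sd0 : 0 <= (s - s1) / d i by rewrite divr_ge0 ?subr_ge0// ltW.
    have /andP[j1 j2] := truncn_itv sd0.
    apply: (AM j).
      by rewrite ltnS; apply: le_truncn; rewrite ler_pM2r ?invr_gt0// lerD2r.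
    split => //; exists s; split => //.
      by rewrite -lerBrDl -ler_pdivlMr.
    by rewrite -lerBlDl -ler_pdivrMr// ltW.
  apply: (le_trans lM); rewrite lee_fin /q /C.
  have -> : (2 * (3 * d i / c)) ^+ n = (6 / c) ^+ n * d i ^+ m * d i.
    by rewrite -[RHS]mulrA -exprSr -exprMn; congr (_ ^+ _); ring.
  have : (Num.truncn (T / d i))%:R <= T / d i by rewrite truncn_le divr_ge0// ltW.
  rewrite ler_pdivlMr// => hJ.
  have hJ' : J%:R * d i <= T + 1 by rewrite /J -natr1 mulrDl mul1r lerD.
  set A' := (6 / c) ^+ n; set D := d i ^+ m.
  have -> : J%:R * (A' * D * d i) = A' * D * (J%:R * d i) by ring.
  have -> : A' * (T + 1) * D = A' * D * (T + 1) by ring.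
  apply: ler_wpM2l => //; apply: mulr_ge0; apply: exprn_ge0; last exact: ltW.
  by rewrite divr_ge0// ltW.
have [M MP] := choice coverU.
exists (\bigcup_i M i); split.
- by apply: bigcup_measurable => i _; have [] := MP i.
- move=> y [y1 [s [ss1 ss2 cs /EU[i _ Us]]]]; exists i => //.
  by have [_ h1 _] := MP i; exact: (h1 y s).
have mM i : measurable (M i) by have [] := MP i.
apply: (le_trans (generalized_Boole_inequality leb mM _)).
  by apply: bigcup_measurable => i _; exact: mM.
apply: (@le_trans _ _ (\sum_(0 <= i <oo) (C%:E * (d i ^+ m)%:E))%E).
  by apply: lee_nneseries => // i _; have [_ _] := MP i; rewrite EFinM.
rewrite nneseriesZl; last by move=> i _; rewrite lee_fin exprn_ge0// ltW.
apply: (@le_trans _ _ (C%:E * eta'%:E)%E).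
  by apply: lee_wpmul2l => //; rewrite lee_fin ltW.
rewrite -EFinM lee_fin mulrC -ler_pdivlMr//.
by rewrite ge_min lexx orbT.
Qed.

Lemma far_hitting_set_negligible (c : R) : 0 < c -> leb.-negligible (far_hitting_set c).
Proof.
move=> c0; have inv0 k : 0 < k.+1%:R^-1 :> R by rewrite invr_gt0.
have [M MP] := choice (fun k => far_hitting_set_cover c0 (inv0 k)).
exists (\bigcap_k M k); split.
- by apply: bigcapT_measurable => k; have [] := MP k.
- apply/eqP; rewrite eq_le measure_ge0 andbT.
  apply/lee_addgt0Pr => eps eps0; rewrite add0e.
  pose k := Num.truncn (eps^-1).
  have [mMk _ lMk] := MP k.
  apply: (@le_trans _ _ (leb (M k))).
    apply: le_measure; rewrite ?inE//.
      by apply: bigcapT_measurable => j; have [] := MP j.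
    exact: bigcap_inf.
  apply: (le_trans lMk); rewrite lee_fin -[leRHS]invrK lef_pV2 ?posrE ?invr_gt0//.
  by apply: ltW; exact: truncnS_gt.
by move=> y by_ k _; have [_ h1 _] := MP k; exact: h1.
Qed.

Definition hitting_set : set V :=
  [set y | `|y| <= 1 /\ exists s, [/\ s1 <= s, s <= s2, 0 < dl (h s) &
     E (h s + dl (h s) *: y)]].

Lemma hitting_negligible : leb.-negligible hitting_set.
Proof.
apply: (negligibleS (A := \bigcup_k far_hitting_set k.+1%:R^-1)); last first.
  by apply: negligible_bigcup => k; apply: far_hitting_set_negligible; rewrite invr_gt0.
move=> y [y1 [s [ss1 ss2 ds Es]]].
exists (Num.truncn (dl (h s))^-1) => //; split => //.
exists s; split => //.
rewrite -[leRHS]invrK lef_pV2 ?posrE ?invr_gt0//.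
by apply: ltW; exact: truncnS_gt.
Qed.

End bad_translates.

(** * Distance to a set and crossing paths *)

Section distance.
Context {R : realType} {n : nat}.
Local Notation V := 'rV[R]_n.
Variable F : set V.
Hypotheses (F0 : F !=set0) (cF : closed F).

Definition set_dist (x : V) : R := inf [set `|x - p| | p in F].

Let has_inf_dist x : has_inf [set `|x - p| | p in F].
Proof.
split; first by have [p Fp] := F0; exists `|x - p|; exists p.
by exists 0 => _ [p _ <-].
Qed.

Lemma set_dist_le x p : F p -> set_dist x <= `|x - p|.
Proof. by move=> Fp; apply: ge_inf; [have [] := has_inf_dist x|exists p]. Qed.

Lemma set_dist_ge0 x : 0 <= set_dist x.
Proof.
apply: lb_le_inf; first by have [] := has_inf_dist x.
by move=> _ [p _ <-].
Qed.

Lemma set_dist_eq0 x : F x -> set_dist x = 0.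
Proof.
move=> Fx; apply/le_anti; rewrite set_dist_ge0 andbT.
by have := set_dist_le x Fx; rewrite subrr normr0.
Qed.

Lemma set_dist_gt0 x : ~ F x -> 0 < set_dist x.
Proof.
move=> nFx; have : nbhs x (~` F) by apply: open_nbhs_nbhs; split => //;
  exact: closed_openC.
move=> /nbhs_ballP[eps /= eps0 epsF]; apply: (lt_le_trans eps0).
apply: lb_le_inf; first by have [] := has_inf_dist x.
move=> _ [p Fp <-]; rewrite leNgt; apply/negP => xp; apply: (epsF p) => //.
by rewrite mx_norm_ball.
Qed.

Lemma set_dist_lip x z : `|set_dist x - set_dist z| <= `|x - z|.
Proof.
have h u v : set_dist u - `|u - v| <= set_dist v.
  apply: lb_le_inf; first by have [] := has_inf_dist v.
  move=> _ [p Fp <-]; rewrite lerBlDr (le_trans (set_dist_le u Fp))//.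
  by rewrite -(subrKA v) addrC (le_trans (ler_normD _ _)).
have := h x z; have := h z x; rewrite distrC ler_norml => h1 h2.
by apply/andP; split; lra.
Qed.

Variable e : R.
Hypothesis e0 : 0 < e.

Definition push_radius (x : V) : R := e * set_dist x.

Lemma push_radius_ge0 x : 0 <= push_radius x.
Proof. by rewrite mulr_ge0 ?(ltW e0)// set_dist_ge0. Qed.

Lemma push_radius_lip x z : `|push_radius x - push_radius z| <= e * `|x - z|.
Proof.
by rewrite -mulrBr normrM gtr0_norm// ler_wpM2l ?(ltW e0)// set_dist_lip.
Qed.

Lemma push_radius_eq0 x : F x -> push_radius x = 0.
Proof. by move=> Fx; rewrite /push_radius set_dist_eq0// mulr0. Qed.

Lemma push_radius_gt0 x : ~ F x -> 0 < push_radius x.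
Proof. by move=> nFx; rewrite mulr_gt0// set_dist_gt0. Qed.

End distance.

Section lipschitz_path.
Context {R : realType} {n : nat}.
Local Notation V := 'rV[R]_n.

Lemma lipschitz_continuous_rV (f : R -> V) (K : R) : 0 < K ->
  (forall s t, `|f s - f t| <= K * `|s - t|) -> continuous f.
Proof.
move=> K0 fK x A /nbhs_ballP[eps /= eps0 epsA]; apply/nbhs_ballP.
exists (eps / K) => /=; first exact: divr_gt0.
move=> z; rewrite /ball /= => xz; apply: epsA; rewrite mx_norm_ball /ball_ /=.
by rewrite (le_lt_trans (fK _ _))// mulrC -ltr_pdivlMr.
Qed.

Lemma continuous_measurable_rV (f : R -> V) : continuous f -> measurable_fun setT f.
Proof.
move=> cf; apply: measurable_fun_rV => i; apply: continuous_measurable_fun => x.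
apply: (@continuous_comp _ _ _ f (fun v : V => v ord0 i)); first exact: cf.
exact: coord_continuous.
Qed.

(** Let s2 be the first time in F2 and s1 the last time in F1 before s2. *)
Lemma crossing (f : R -> V) (F1 F2 : set V) (L : R) : continuous f ->
  closed F1 -> closed F2 -> 0 <= L -> F1 (f 0) -> F2 (f L) ->
  exists s1 s2, [/\ 0 <= s1, s1 <= s2, s2 <= L, F1 (f s1) & F2 (f s2) /\
    forall s, s1 < s -> s < s2 -> ~ (F1 `|` F2) (f s)].
Proof.
move=> cf cF1 cF2 L0 F10 F2L.
have cK (F : set V) l : closed F -> compact (`[0, l]%classic `&` f @^-1` F).
  move=> cF; apply: compact_closedI; first exact: segment_compact.
  by apply: (proj1 (continuous_closedP f)) => //.
have cid (A : set R) : {within A, continuous (id : R -> R)}.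
  by apply: continuous_subspaceT => x.
have A2 : `[0, L]%classic `&` f @^-1` F2 !=set0.
  by exists L; split => //=; rewrite in_itv/= L0 lexx.
have [s2] := compact_EVT_min A2 (cK F2 L cF2) (cid _).
rewrite inE => -[/=]; rewrite in_itv/= => /andP[s20 s2L] Fs2 s2min.
have A1 : `[0, s2]%classic `&` f @^-1` F1 !=set0.
  by exists 0; split => //=; rewrite in_itv/= s20 lexx.
have [s1] := compact_EVT_max A1 (cK F1 s2 cF1) (cid _).
rewrite inE => -[/=]; rewrite in_itv/= => /andP[s10 s12] Fs1 s1max.
exists s1, s2; split => //; split => // s ss1 ss2 [Fs|Fs].
  have : s <= s1.
    apply: s1max; rewrite inE; split => //=.
    by rewrite in_itv/= (ltW ss2) (le_trans s10)// ltW.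
  by rewrite leNgt ss1.
have : s2 <= s.
  apply: s2min; rewrite inE; split => //=.
  by rewrite in_itv/= (le_trans s10 (ltW ss1)) (le_trans (ltW ss2)).
by rewrite leNgt ss2.
Qed.

End lipschitz_path.

(** * Pushed paths and the admissibility of the average *)

Section perturbation.
Context {R : realType} {m : nat}.
Local Notation n := m.+1.
Local Notation V := 'rV[R]_n.
Local Notation leb := (@lebesgue_rV R n).
Variables (E F1 F2 : set V) (rho : V -> \bar R) (e : R).
Hypotheses (m0 : (0 < m)%N) (e0 : 0 < e) (e1 : e < 1).
Hypothesis E0 : hausdorff_measure (m%:R : R) E = 0%E.
Hypotheses (cF1 : closed F1) (cF2 : closed F2) (F10 : F1 !=set0).
Hypothesis adm : admissible (curves_between F1 F2 `&` curves_off E) rho.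

Local Notation F := (F1 `|` F2).
Local Notation K := (1 + e * n%:R).
Local Notation rad := (push_radius F e).

Let F0 : F !=set0.
Proof. by have [p Fp] := F10; exists p; left. Qed.

Let cF : closed F.
Proof. exact: closedU. Qed.

Let rad_ge0 := push_radius_ge0 F0 e0.
Let rad_lip := push_radius_lip F0 e0.
Let rad_eq0 := push_radius_eq0 F0 e.
Let rad_gt0 := push_radius_gt0 F0 cF e0.

Let K0 : 0 < K.
Proof. by rewrite ltr_pwDl// mulr_ge0// ltW. Qed.

Section along_curve.
Variables (h : R -> V) (s1 s2 : R).
Hypothesis h_lip : forall s t, enorm (h s - h t) <= `|s - t|.
Hypotheses (s12 : s1 <= s2) (h1 : F1 (h s1)) (h2 : F2 (h s2)).
Hypothesis h_off : forall s, s1 < s -> s < s2 -> ~ F (h s).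

Definition push (y : V) (s : R) : V := h s + rad (h s) *: y.

Lemma push_lip y s t : `|y| <= 1 ->
  enorm (push y s - push y t) <= K * `|s - t|.
Proof.
move=> y1; rewrite /push.
have -> : h s + rad (h s) *: y - (h t + rad (h t) *: y) =
   (h s - h t) + (rad (h s) - rad (h t)) *: y.
  by apply/rowP => i; rewrite !mxE; ring.
apply: le_trans (ler_enormD _ _) _; rewrite mulrDl mul1r lerD// enormZ.
rewrite mulrAC; apply: ler_pM => //; first exact: enorm_ge0.
  apply: le_trans (rad_lip _ _) _; rewrite ler_wpM2l ?(ltW e0)//.
  by apply: le_trans (norm_le_enorm _) _; exact: h_lip.
by apply: le_trans (enorm_le_norm _) _; rewrite ler_piMr.
Qed.

Lemma push_continuous y : `|y| <= 1 -> continuous (push y).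
Proof.
move=> y1; apply: (lipschitz_continuous_rV K0) => s t.
by apply: le_trans (norm_le_enorm _) _; exact: push_lip.
Qed.

Definition push_curve y (y1 : `|y| <= 1) : curve R n :=
  Curve s12 (continuous_subspaceT (push_continuous y1)).

Local Notation hitting := (hitting_set rad h E s1 s2).

(** The endpoints lie in F, where the radius is 0, so the pushed path still joins
F1 to F2; off the hitting set it avoids E in between. *)
Lemma push_integral_ge1 y : `|y| <= 1 -> ~ hitting y ->
  (1 <= K%:E * \int[lebesgue_measure]_(s in `]s1, s2[%classic) rho (push y s))%E.
Proof.
move=> y1 ny; pose g := push_curve y1.
have [mrho rho0 admg] := adm.
have gK s t : s1 <= s -> s <= t -> t <= s2 -> enorm (g t - g s) <= K * (t - s).
  by move=> _ st _; apply: le_trans (push_lip _ _ y1) _; rewrite ger0_norm// subr_ge0.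
have rg : rectifiable g := @lipschitz_rectifiable _ _ g _ gK.
have mg : measurable_fun setT g.
  by apply: continuous_measurable_rV; exact: push_continuous.
have pushE s : F (h s) -> push y s = h s.
  by move=> Fs; rewrite /push rad_eq0// scale0r addr0.
have gb : (curves_between F1 F2 `&` curves_off E) g.
  split.
    by split; rewrite /= pushE//; [left|right].
  apply/seteqP; split => // z [[[s /=]]]; rewrite in_itv/= => /andP[ss1 ss2] <- nz Ez.
  apply: ny; split => //; exists s; split => //.
  apply: rad_gt0; apply: h_off.
    rewrite lt_neqAle ss1 andbT; apply/eqP => ss; apply: nz; left.
    by rewrite /= ss.
  rewrite lt_neqAle ss2 andbT; apply/eqP => ss; apply: nz; right.
  by rewrite /= ss.
apply: le_trans (admg g gb rg) _.
apply: le_trans (@line_integral_lipschitz _ _ g _ K0 gK _ mg mrho rho0) _.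
rewrite /= (@integral_itv_bndoo _ _ _ _ true false)//.
by apply: measurable_funTS; exact: measurableT_comp.
Qed.

(** Integrate [push_integral_ge1] over the unit ball in y and exchange the two
integrals.  The open interval ]s1, s2[ matters: at its endpoints the radius
vanishes and the average is 0. *)
Lemma average_along_ge1 :
  (1 <= K%:E * \int[lebesgue_measure]_(s in `]s1, s2[%classic)
                 average rad rho (h s))%E.
Proof.
have [mrho rho0 _] := adm.
pose Q : set V := cube 0 1; pose J : set (measurableTypeR R) := `]s1, s2[%classic.
have mQ : measurable Q by exact: measurable_cube.
have mJ : measurable J by exact: measurable_itv.
have h_cont : continuous h.
  apply: (lipschitz_continuous_rV ltr01) => s t; rewrite mul1r.
  by apply: le_trans (norm_le_enorm _) _; exact: h_lip.
have mh : @measurable_fun _ _ (measurableTypeR R) _ setT h.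
  exact: continuous_measurable_rV.
have mrad : measurable_fun setT rad by exact: (measurable_dl e1 rad_lip).
pose P (p : V * measurableTypeR R) := rho (push p.1 p.2).
have mpush : measurable_fun setT (fun p : V * measurableTypeR R => push p.1 p.2).
  apply: measurable_fun_rV => i; under eq_fun do rewrite !mxE.
  apply: measurable_funD.
    apply: (measurableT_comp (@measurable_coord R n i)).
    by apply: (measurableT_comp mh); exact: measurable_snd.
  apply: measurable_funM.
    apply: (measurableT_comp mrad).
    by apply: (measurableT_comp mh); exact: measurable_snd.
  by apply: (measurableT_comp (@measurable_coord R n i)); exact: measurable_fst.
have mP : measurable_fun setT P by exact: (measurableT_comp mrho mpush).
have P0 p : (0 <= P p)%E by exact: rho0.
pose f := P \_ (Q `*` J).
have mf : measurable_fun setT f.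
  apply: (measurable_restrictT _ _).1; first exact: measurableX.
  exact: measurable_funTS.
have f0 p : (0 <= f p)%E by apply: erestrict_ge0.
have Gf y : (\int[lebesgue_measure]_s f (y, s))%E =
    ((fun y => \int[lebesgue_measure]_(s in J) rho (push y s)) \_ Q)%E y.
  rewrite patchE; case: ifPn => [/set_mem Qy|/negP Qy].
    rewrite [RHS]integral_mkcond; apply: eq_integral => s _; rewrite /f !patchE.
    case: ifPn => [/set_mem [_ Js]|/negP QJ]; first by rewrite mem_set.
    by rewrite memNset// => Js; apply: QJ; rewrite mem_set.
  apply: integral0_eq => s _; rewrite /f patchE memNset// => -[Qy' _].
  by apply: Qy; rewrite mem_set.
have Hf s : (\int[leb]_y f (y, s))%E =
    ((fun s => \int[leb]_(y in Q) rho (push y s)) \_ J)%E s.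
  rewrite patchE; case: ifPn => [/set_mem Js|/negP Js].
    rewrite [RHS]integral_mkcond; apply: eq_integral => y _; rewrite /f !patchE.
    case: ifPn => [/set_mem [Qy _]|/negP QJ]; first by rewrite mem_set.
    by rewrite memNset// => Qy; apply: QJ; rewrite mem_set.
  apply: integral0_eq => y _; rewrite /f patchE memNset// => -[_ Js'].
  by apply: Js; rewrite mem_set.
have mavg : measurable_fun setT (average rad rho).
  exact: (measurable_average e1 rad_ge0 rad_lip).
have avg0 x : (0 <= average rad rho x)%E by exact: (average_ge0 rad_ge0).
have mavgh : @measurable_fun _ _ (measurableTypeR R) _ J (fun s => average rad rho (h s)).
  by apply: measurable_funTS; exact: measurableT_comp.
have swap : (\int[leb]_(y in Q) \int[lebesgue_measure]_(s in J) rho (push y s) =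
    (2 ^+ n)%:E * \int[lebesgue_measure]_(s in J) average rad rho (h s))%E.
  rewrite [LHS]integral_mkcond; under [LHS]eq_integral do rewrite -Gf.
  rewrite (fubini_tonelli (m1 := leb) (m2 := @lebesgue_measure R) f mf f0).
  under [LHS]eq_integral do rewrite Hf.
  rewrite -[LHS]integral_mkcond -ge0_integralZl//.
  apply: eq_integral => s /set_mem; rewrite /J/= in_itv/= => /andP[ss1 ss2].
  rewrite (average_rescaled e1 rad_ge0 rad_lip mrho rho0 (rad_gt0 (h_off ss1 ss2))).
  by rewrite muleA -EFinM divff ?mul1e// expf_neq0.
have mG : measurable_fun Q (fun y => \int[lebesgue_measure]_(s in J) rho (push y s))%E.
  apply/(measurable_restrictT _ mQ).
  apply: (eq_measurable_fun (fun y => \int[lebesgue_measure]_s f (y, s))%E).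
    by move=> y _; rewrite Gf.
  exact: (measurable_fun_fubini_tonelli_F (m2 := @lebesgue_measure R) f mf f0).
have G0 y : (0 <= \int[lebesgue_measure]_(s in J) rho (push y s))%E.
  by apply: integral_ge0.
have : (\int[leb]_(y in Q) 1 <=
   \int[leb]_(y in Q) (K%:E * \int[lebesgue_measure]_(s in J) rho (push y s)))%E.
  apply: ae_ge0_le_integral => //.
  - by move=> y _; rewrite mule_ge0 ?lee_fin ?(ltW K0).
  - exact: measurable_funeM.
  apply: (negligibleS (A := hitting)); last first.
    apply: (hitting_negligible m0 (ltW e1) rad_lip _ E0 s12) => s t.
    by apply: le_trans (norm_le_enorm _) _; exact: h_lip.
  move=> y /not_implyP[Qy ny]; apply/not_notP => nh; apply: ny.
  by apply: push_integral_ge1 => //; move: Qy; rewrite /Q /cube /= subr0.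
rewrite integral_cst// mul1e ge0_integralZl// ?lee_fin ?(ltW K0)//.
have lQ : ((2 ^+ n)%:E = leb Q)%E.
  by rewrite -[in LHS](mulr1 2) -(lebesgue_cube (0 : V) ler01).
rewrite swap muleCA => /(le_trans (_ : (2 ^+ n)%:E <= leb Q)%E) h3.
by rewrite -(@lee_pmul2l _ (2 ^+ n)%:E) ?mule1 ?lte_fin ?exprn_gt0// h3// lQ.
Qed.

End along_curve.

Lemma admissible_average :
  admissible (curves_between F1 F2) (fun x => K%:E * average rad rho x)%E.
Proof.
have [mrho rho0 _] := adm.
have mavg : measurable_fun setT (average rad rho).
  exact: (measurable_average e1 rad_ge0 rad_lip).
have avg0 x : (0 <= average rad rho x)%E by exact: (average_ge0 rad_ge0).
split; first exact: measurable_funeM.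
  by move=> x; rewrite mule_ge0// lee_fin ltW.
move=> g [g1 g2] rg; set L := fine (curve_length g).
have L0 : 0 <= L := fine_curve_length_ge0 g.
pose h s := arclength_param g (clamp 0 L s).
have h_lip s t : enorm (h s - h t) <= `|s - t|.
  wlog ts : s t / t <= s.
    move=> wl; have [|st] := leP t s; first exact: wl.
    by rewrite distrC -opprB -scaleN1r enormZ normrN1 mul1r wl// ltW.
  rewrite ger0_norm ?subr_ge0//; apply: le_trans (clamp_lip 0 L ts).
  by apply: arclength_param_lip => //; [exact: clamp_ge|exact: clamp_nd|exact: clamp_le].
have h_cont : continuous h.
  apply: (lipschitz_continuous_rV ltr01) => s t; rewrite mul1r.
  by apply: le_trans (norm_le_enorm _) _; exact: h_lip.
have mh : @measurable_fun _ _ (measurableTypeR R) _ setT h.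
  exact: continuous_measurable_rV.
have h0 : F1 (h 0) by rewrite /h clamp_id// arclength_param0.
have hL : F2 (h L) by rewrite /h clamp_id// arclength_paramL.
have [s1 [s2 [s10 s12 s2L Fs1 [Fs2 off]]]] := crossing h_cont cF1 cF2 L0 h0 hL.
apply: le_trans (average_along_ge1 h_lip s12 Fs1 Fs2 off) _.
have mavgh (D : set (measurableTypeR R)) :
    measurable_fun D (fun s : measurableTypeR R => average rad rho (h s)).
  by apply: measurable_funTS; exact: measurableT_comp.
have mI : measurable (`[0, L]%classic : set (measurableTypeR R)).
  exact: measurable_itv.
have -> : line_integral g (fun x => K%:E * average rad rho x)%E =
    (\int[@lebesgue_measure R]_(s in `[0%R, L]%classic) (K%:E * average rad rho (h s)))%E.
  apply: eq_integral => s; rewrite inE/= in_itv/= => /andP[s0 sL].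
  by rewrite /h clamp_id.
have KE : (0 <= K%:E)%E by rewrite lee_fin ltW.
rewrite (ge0_integralZl (@lebesgue_measure R) mI (mavgh _) (fun s _ => avg0 (h s)) KE).
apply: (lee_wpmul2l KE).
apply: (ge0_subset_integral (@lebesgue_measure R) _ mI (mavgh _)) => //.
- move=> s /=; rewrite !in_itv/= => /andP[ss1 ss2].
  by rewrite (le_trans s10 (ltW ss1)) (le_trans (ltW ss2)).
Qed.

End perturbation.

(** * Comparison of the moduli *)

Lemma expeMn {R : realType} (x y : \bar R) (k : nat) :
  ((x * y) ^+ k = x ^+ k * y ^+ k)%E.
Proof.
by elim: k => [|k IH]; rewrite ?expe0 ?mule1// !expeS IH muleACA.
Qed.

Section limit.
Context {R : realType}.

Lemma expr1D_le (k : nat) (x : R) : 0 <= x -> x <= 1 ->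
  (1 + x) ^+ k <= 1 + 3 ^+ k * x.
Proof.
move=> x0 x1; elim: k => [|k IH]; first by rewrite !expr0 mul1r lerDl.
rewrite !exprS; have c1 : 1 <= 3 ^+ k :> R by rewrite exprn_ege1// ler1n.
have x10 : 0 <= 1 + x by rewrite addr_ge0.
apply: le_trans (ler_wpM2l x10 IH) _.
set A := 3 ^+ k in c1 *.
have : 0 <= A * x * (1 - x) by rewrite !mulr_ge0 ?subr_ge0// (le_trans _ c1).
have : 0 <= (A - 1) * x by rewrite mulr_ge0// subr_ge0.
lra.
Qed.

(** The left-hand side is the factor lost in the energy, which tends to 1 with e.
For e <= 1/2 one has 1 / (1 - e) <= 1 + 2 e, so it is at most (1 + N e)^(3 n)
with N = n + 2. *)
Lemma exists_small_loss (n : nat) (eta : R) : 0 < eta ->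
  exists e : R, [/\ 0 < e, e < 1 &
    ((1 + e * n%:R) * ((1 + e) / (1 - e))) ^+ n <= 1 + eta].
Proof.
move=> eta0.
pose N : R := n%:R + 2; have N2 : 2 <= N by rewrite /N lerDr.
pose B : R := 3 ^+ (3 * n); have B1 : 1 <= B by rewrite /B exprn_ege1// ler1n.
pose e := Num.min N^-1 (eta / (B * N)).
have N0 : 0 < N by lra.
have B0 : 0 < B by lra.
have e0 : 0 < e by rewrite /e lt_min invr_gt0 N0 divr_gt0// mulr_gt0.
have eN : e * N <= 1 by rewrite -ler_pdivlMr// div1r /e ge_min lexx.
have eB : B * (N * e) <= eta.
  by rewrite mulrA mulrC -ler_pdivlMr ?mulr_gt0// /e ge_min lexx orbT.
have e2 : e <= 1 / 2.
  by rewrite ler_pdivlMr//; apply: le_trans eN; rewrite ler_wpM2l// ltW.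
exists e; split => //; first by lra.
have Ne0 : 0 <= N * e by rewrite mulr_ge0// ltW.
apply: (@le_trans _ _ ((1 + N * e) ^+ (3 * n))); last first.
  apply: le_trans (expr1D_le _ Ne0 _) _; first by rewrite mulrC.
  by rewrite lerD2l.
have e1 : 0 < 1 - e by lra.
have e1' : 0 <= 1 + e by lra.
have a0 : 0 <= 1 + e * n%:R by rewrite addr_ge0// mulr_ge0// ltW.
have b0 : 0 <= (1 + e) / (1 - e) by rewrite divr_ge0// ltW.
have X1 : 0 <= 1 + N * e by rewrite addr_ge0.
rewrite exprM; apply: lerXn2r; rewrite ?nnegrE; [exact: mulr_ge0|exact: exprn_ge0|].
rewrite exprS; apply: ler_pM => //.
  by rewrite lerD2l mulrC ler_wpM2r ?(ltW e0)// /N lerDl.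
rewrite expr2; apply: (@le_trans _ _ ((1 + e) * (1 + 2 * e))).
  rewrite ler_wpM2l// -div1r ler_pdivrMr//.
  have : 0 <= e * (1 - 2 * e) by rewrite mulr_ge0 ?(ltW e0)// subr_ge0; lra.
  lra.
have h : 2 * e <= N * e by rewrite ler_wpM2r// ltW.
by apply: ler_pM; lra.
Qed.

End limit.

Lemma modulus_le {R : realType} {n : nat} (G G' : set (curve R n)) :
  G `<=` G' -> (modulus G <= modulus G')%E.
Proof.
move=> GG'; apply/ereal_infP => _ [rho [mr r0 adm] <-].
apply: ereal_inf_lbound; exists rho => //; split => // g /GG'; exact: adm.
Qed.

Theorem theorem1p6 (R : realType) (n : nat) (hn : (2 <= n)%N)
  (E : set 'rV[R]_n) (hE : hausdorff_measure (n.-1%:R : R) E = 0%E) :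
  NED E.
Proof.
case: n hn E hE => [//|m]; rewrite ltnS => m0 E /= hE F1 F2 [cF1 _] [cF2 _] F10 _ _.
apply/le_anti/andP; split; last by apply: modulus_le => g [].
have closed_of (F : set 'rV[R]_m.+1) : compact F -> closed F.
  by apply: compact_closed; exact: norm_hausdorff.
apply/ereal_infP => _ [rho adm <-].
have [mrho rho0 _] := adm.
set I := (\int[_]_x _)%E.
have I0 : (0 <= I)%E by apply: integral_ge0 => x _; exact: expe_ge0.
have bound e : 0 < e -> e < 1 ->
    (modulus (curves_between F1 F2) <=
     (((1 + e * m.+1%:R) * ((1 + e) / (1 - e))) ^+ m.+1)%:E * I)%E.
  move=> e0 e1.
  have := admissible_average m0 e0 e1 hE (closed_of _ cF1) (closed_of _ cF2) F10 adm.
  set K := 1 + e * m.+1%:R; set rad := push_radius (F1 `|` F2) e => admK.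
  have F0 : F1 `|` F2 !=set0 by have [p Fp] := F10; exists p; left.
  have K0 : 0 <= K by rewrite addr_ge0// mulr_ge0// ltW.
  have rad0 x : 0 <= rad x by exact: (push_radius_ge0 F0 e0).
  have rad_lip x z : `|rad x - rad z| <= e * `|x - z| by exact: (push_radius_lip F0 e0).
  have mavg := measurable_average e1 rad0 rad_lip mrho rho0.
  have avg0 x : (0 <= average rad rho x)%E by exact: (average_ge0 rad0).
  apply: (@le_trans _ _ (\int[@lebesgue_rV R m.+1]_x
      ((K%:E * average rad rho x) ^+ m.+1))%E).
    by apply: ereal_inf_lbound; exists (fun x => K%:E * average rad rho x)%E.
  under eq_integral do rewrite expeMn -EFin_expe.
  rewrite ge0_integralZl//.
  - rewrite exprMn EFinM -muleA lee_wpmul2l ?lee_fin ?exprn_ge0//.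
    exact: (integral_average_pow (ltW e0) e1 rad0 rad_lip mrho rho0).
  - exact: measurable_fun_expe.
  - by move=> x _; exact: expe_ge0.
  - by rewrite lee_fin exprn_ge0.
case: I I0 bound => [r| |]// r0 bound; last by rewrite leey.
apply/lee_addgt0Pr => eps eps0.
have eta0 : 0 < eps / (r + 1) by rewrite divr_gt0// ltr_wpDl.
have [e [e0 e1 He]] := exists_small_loss m.+1 eta0.
apply: le_trans (bound e e0 e1) _; rewrite -EFinM -EFinD lee_fin.
apply: le_trans (ler_wpM2r r0 He) _; rewrite mulrDl mul1r lerD2l.
by rewrite mulrAC ler_pdivrMr ?ltr_wpDl// ler_wpM2l ?(ltW eps0)// lerDl.
Qed.
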